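(* For any $\sigma\in \mathbf{S}_n^2$ one has $$\overline{\mathcal{B}}_\sigma=\mathcal{V}_\sigma=\coprod_{\sigma'\in\mathbf{S}_n^2,\ \sigma'\leq\sigma}\mathcal{B}_{\sigma'}.$$
   Context: Let $\mathfrak{n}$ be the space of strictly upper-triangular complex $n\times n$ matrices and $\mathbf{B}$ the group of invertible upper-triangular complex $n\times n$ matrices, acting on $\mathfrak{n}$ by conjugation. Let $\mathbf{S}_n^2=\{\sigma\in \mathbf{S}_n : \sigma^2=\mathrm{Id}\}$. Write $\sigma\in\mathbf{S}_n^2$ as a product of disjoint 2-cycles $\sigma=(i_1,j_1)\cdots(i_k,j_k)$ with $i_s<j_s$ and $i_1<\dots<i_k$ ($k=0$ for the identity). Let $N_\sigma\in\mathfrak{n}$ be the matrix with $(N_\sigma)_{i_s,j_s}=1$ for $1\le s\le k$ and all other entries $0$, and let $\mathcal{B}_\sigma=\{AN_\sigma A^{-1} : A\in\mathbf{B}\}$. The bar denotes (Zariski) closure in $\mathfrak{n}$. For an upper-triangular matrix $u$ and $i\le j$ let $\pi_{i,j}(u)$ be the submatrix of $u$ with rows and columns $i,i+1,\dots,j$. Let $R_\sigma$ be the $n\times n$ matrix with $(R_\sigma)_{i,j}=\mathrm{rank}\,\pi_{i,j}(N_\sigma)$ for $i<j$ and $(R_\sigma)_{i,j}=0$ for $i\ge j$. Put $\sigma'\leq\sigma$ if $(R_{\sigma'})_{i,j}\le (R_\sigma)_{i,j}$ for all $1\le i,j\le n$. For $1\le i<j\le n$ let $x_{j,i}$ be the coordinate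 function $u\mapsto u_{i,j}$ on $\mathfrak{n}$, so that the ring of polynomial functions on $\mathfrak{n}$ is $\mathbb{C}[x_{j,i}: i<j]$ (identified with the symmetric algebra $S(\mathfrak{n}^-)$ of the space of strictly lower-triangular matrices). Let $N$ be the generic strictly upper-triangular matrix, with $(i,j)$ entry $x_{j,i}$ for $i<j$ and $0$ otherwise. Let $I_2$ be the ideal generated by the polynomials $\sum_{k=j+1}^{i-1}x_{i,k}x_{k,j}$ for $1\le j<i\le n$ (the entries of $N^2$). Let $I_1(\sigma)$ be the ideal generated by all minors of size $(R_\sigma)_{i,j}+1$ of $\pi_{i,j}(N)$, for all $1\le i<j\le n$. Put $\mathcal{I}_\sigma=I_2+I_1(\sigma)$ and let $\mathcal{V}_\sigma\subset\mathfrak{n}$ be the zero variety of $\mathcal{I}_\sigma$. *)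

(* Defs.v *)
From mathcomp Require Import all_boot all_order all_algebra all_fingroup.
From mathcomp Require Import mpoly.
From mathcomp Require Import complex.
From mathcomp Require Import classical_sets reals.

Set Implicit Arguments.
Unset Strict Implicit.
Unset Printing Implicit Defensive.

Import GRing.Theory.
Local Open Scope classical_set_scope.
Local Open Scope ring_scope.

Section Matrices.
Variables (F : fieldType) (n : nat).

(* Indices are 0-based: the rows and columns are 0, ..., n-1. *)
Definition strictly_upper : set 'M[F]_n :=
  [set u | forall i j : 'I_n, (j <= i)%N -> u i j = 0].

Definition borel_group : set 'M[F]_n :=
  [set A | A \in unitmx /\ forall i j : 'I_n, (j < i)%N -> A i j = 0].

Definition involutions : set 'S_n := [set s | s ^+ 2 = 1]%g.

(* The 2-cycles (i, j) with i < j of an involution s are the pairs such that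
   i < j and s i = j. *)
Definition N_of (s : 'S_n) : 'M[F]_n :=
  \matrix_(i, j) ((i < j)%N && (s i == j))%:R.

Definition B_orbit (s : 'S_n) : set 'M[F]_n :=
  [set A *m N_of s *m invmx A | A in borel_group].

End Matrices.

Arguments involutions {n}.
Arguments N_of F {n} s.
Arguments B_orbit F {n} s.

Lemma window_subproof n (i j : 'I_n) (k : 'I_(j.+1 - i)) : (i + k < n)%N.
Proof.
apply: leq_trans _ (ltn_ord j).
by rewrite -ltn_subRL.
Qed.

Definition window n (i j : 'I_n) (k : 'I_(j.+1 - i)) : 'I_n :=
  Ordinal (window_subproof k).

(* [pi_sub i j u] has rows and columns i, ..., j; it is empty when j < i. *)
Definition pi_sub (T : Type) n (i j : 'I_n) (u : 'M[T]_n) :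
    'M[T]_(j.+1 - i) :=
  mxsub (@window n i j) (@window n i j) u.

Definition rank_matrix (F : fieldType) n (s : 'S_n) : 'M[nat]_n :=
  \matrix_(i, j) if (i < j)%N then \rank (pi_sub i j (N_of F s)) else 0%N.

Arguments rank_matrix F {n} s.

Definition rank_le (F : fieldType) n (s' s : 'S_n) : Prop :=
  forall i j : 'I_n, (rank_matrix F s' i j <= rank_matrix F s i j)%N.

Arguments rank_le F {n} s' s.

Definition minors (T : comPzRingType) m (r : nat) (M : 'M[T]_m) : set T :=
  [set d | exists f g : 'I_r -> 'I_m,
     [/\ {homo f : a b / (a < b)%N}, {homo g : a b / (a < b)%N}
       & d = \det (mxsub f g M)]].

(* The library's [idealr_closed] only covers proper ideals. *)
Definition is_ideal (T : comPzRingType) (I : set T) : Prop :=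
  [/\ I 0, forall p q, I p -> I q -> I (p + q)
    & forall a p, I p -> I (a * p)].

Definition ideal_gen (T : comPzRingType) (S : set T) : set T :=
  smallest (@is_ideal T) S.

Definition ideal_add (T : comPzRingType) (I J : set T) : set T :=
  [set p + q | p in I & q in J].

(* The variables are indexed by the positions strictly above the diagonal. *)
Definition upper_pos (n : nat) : finType :=
  {p : 'I_n * 'I_n | (p.1 < p.2)%N}.

Definition nvars (n : nat) : nat := #|upper_pos n|.

Section Polynomials.
Variables (F : fieldType) (n : nat).

(* [x_ j i] is the coordinate function u |-> u i j if i < j (row index last,
   as for a basis of the strictly lower-triangular matrices), else it is 0. *)
Definition x_ (j i : 'I_n) : {mpoly F[nvars n]} :=
  if insub (i, j) is Some p then 'X_(enum_rank (p : upper_pos n)) else 0.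

Definition coords (u : 'M[F]_n) (k : 'I_(nvars n)) : F :=
  let p := val (enum_val k : upper_pos n) in u p.1 p.2.

Lemma meval_x (u : 'M[F]_n) (i j : 'I_n) :
  strictly_upper u -> (x_ j i).@[coords u] = u i j.
Proof.
move=> hu; rewrite /x_; case: insubP => [p _ pE|/= ij].
  by rewrite mevalXU /coords enum_rankK pE.
by rewrite meval0 hu // leqNgt.
Qed.

Definition zero_locus (S : set {mpoly F[nvars n]}) : set 'M[F]_n :=
  [set u | strictly_upper u /\ forall p, S p -> p.@[coords u] = 0].

Definition zariski_closed (Z : set 'M[F]_n) : Prop :=
  exists S : set {mpoly F[nvars n]}, Z = zero_locus S.

Definition zariski_closure (Z : set 'M[F]_n) : set 'M[F]_n :=
  smallest zariski_closed Z.

Definition generic_mx : 'M[{mpoly F[nvars n]}]_n :=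
  \matrix_(i, j) if (i < j)%N then x_ j i else 0.

Definition I_2 : set {mpoly F[nvars n]} :=
  ideal_gen [set p | exists i j : 'I_n, (j < i)%N /\
    p = \sum_(k < n | (j < k < i)%N) x_ i k * x_ k j].

Definition I_1 (s : 'S_n) : set {mpoly F[nvars n]} :=
  ideal_gen [set p | exists i j : 'I_n, (i < j)%N /\
    minors (rank_matrix F s i j).+1 (pi_sub i j generic_mx) p].

Definition I_ (s : 'S_n) : set {mpoly F[nvars n]} := ideal_add I_2 (I_1 s).

Definition V_ (s : 'S_n) : set 'M[F]_n := zero_locus (I_ s).

End Polynomials.

Arguments I_2 : clear implicits.
Arguments I_1 F {n} s.
Arguments I_ F {n} s.
Arguments V_ F {n} s.

(* Main.v *)
Require Import Defs.
From mathcomp Require Import all_boot all_order all_algebra all_fingroup.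
From mathcomp Require Import zify ring.
From mathcomp Require Import mpoly.
From mathcomp Require Import complex.
From mathcomp Require Import classical_sets reals.

(* By elimination row by row, every strictly upper-triangular matrix of square
   zero is conjugate under the Borel group to some N_s.  The ranks of the
   submatrices pi_{i,j} are invariants of the orbits, and for N_s they count
   the arcs (2-cycles) of s lying inside [i, j]; these counts determine s.
   This gives the decomposition of V_s into disjoint orbits.

   For the closure one has to degenerate N_s to N_u when every interval
   contains at most as many arcs of u as of s.  Copying u and s on a second
   interval, and joining each fixed point to its copy, preserves the order and
   makes the involutions fixed-point free; taking the upper left block brings
   degenerations back.  For fixed-point free involutions the number of arcs
   inside a set P minus the number of arcs inside its complement depends only
   on the size of P, so that the order is invariant under rotation of the
   points put on a circle.  This reduces to the case where a minimal interval
   with strictly more arcs of s than of u starts at the first point; then a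
   crossing of u can be resolved so that the result is still below s.
   Resolving a crossing is reversed by an explicit one-parameter
   degeneration of matrices. *)

Set Implicit Arguments.
Unset Strict Implicit.
Unset Printing Implicit Defensive.

(** * Arcs of an involution inside a set of points *)

Section Inner.
Variable T : finType.
Implicit Types (f g : T -> T) (P Q A Z : pred T).

(** For an involution [f] every arc is seen from both its ends, so this is twice the number of arcs
    inside [P]. *)
Definition inner f P : nat := \sum_a [&& f a != a, P a & P (f a)].

Lemma eq_inner f P Q : P =1 Q -> inner f P = inner f Q.
Proof. by move=> PQ; apply: eq_bigr => a _; rewrite !PQ. Qed.

(** At each [a] this is a case check on [P a] and [P (f a)], and these two indicators have the same
    sum because [f] is a bijection. *)
Lemma innerC f P : involutive f -> (forall a, f a != a) ->
  (inner f P + #|T| = inner f (predC P) + (\sum_a P a).*2)%N.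
Proof.
move=> fK f_neq.
have e : (\sum_a P a = \sum_a P (f a))%N by exact: reindex_inj (can_inj fK).
rewrite -sum1_card -addnn {1}e -!big_split /=.
by apply: eq_bigr => a _; rewrite f_neq /=; case: (P a); case: (P (f a)).
Qed.

Lemma inner_setU1 f P Q i : involutive f -> ~~ P i -> (forall a, Q a = (a == i) || P a) ->
  inner f Q = (inner f P + (P (f i)).*2)%N.
Proof.
move=> fK iNP QE.
have e (b : T) : (\sum_(a : T) ((a == b) && P (f i)) = P (f i))%N.
  by rewrite (bigD1 b) //= eqxx big1 ?addn0 // => a /negbTE ->.
have e2 : (\sum_(a : T) ((a == i) && P (f i)) + \sum_(a : T) ((a == f i) && P (f i)) =
  (P (f i)).*2)%N.
  by rewrite !e addnn.
rewrite -e2 /inner -!big_split /=; apply: eq_bigr => a _.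
rewrite !QE.
have -> : (f a == i) = (a == f i) by rewrite -(inj_eq (can_inj fK)) fK.
case: (eqVneq a i) => [->|ai].
  rewrite (negbTE iNP) !andbF /= [i == _]eq_sym.
  by case: (eqVneq (f i) i) => [->|_]; rewrite /= ?(negbTE iNP) ?addn0 ?eqxx.
case: (eqVneq a (f i)) => [->|afi] /=.
  rewrite fK (negbTE iNP) !andbF !andbT [i == _]eq_sym.
  by case: (eqVneq (f i) i) => [->|_]; rewrite /= ?(negbTE iNP) ?orbF ?eqxx.
by rewrite !addn0.
Qed.

(** The two sides differ by the number of [a] such that one of [a], [f a] lies in [A1] minus [A0]
    and the other in [Z]. *)
Lemma inner_supermod f A0 A1 Z : subpred A0 A1 -> (forall a, A1 a -> ~~ Z a) ->
  (inner f (predU A0 Z) + inner f A1 <= inner f (predU A1 Z) + inner f A0)%N.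
Proof.
move=> A01 dZ; rewrite /inner -!big_split /=; apply: leq_sum => a _.
case: (f a != a) => //=.
move: (A01 a) (A01 (f a)) (dZ a) (dZ (f a)) => /implyP + /implyP + /implyP + /implyP.
by case: (A0 a); case: (A0 (f a)); case: (A1 a); case: (A1 (f a));
  case: (Z a); case: (Z (f a)).
Qed.

(** The last hypothesis excludes the arcs between [A1] minus [A0] and [Z], which are the only defect
    in supermodularity. *)
Lemma inner_modular f A0 A1 Z : involutive f -> subpred A0 A1 ->
  (forall a, A1 a -> ~~ Z a) ->
  (forall a, A1 a -> ~~ A0 a -> ~~ Z (f a)) ->
  (inner f (predU A0 Z) + inner f A1 = inner f (predU A1 Z) + inner f A0)%N.
Proof.
move=> fK A01 dZ h; rewrite /inner -!big_split /=; apply: eq_bigr => a _.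
case: (f a != a) => //=.
move: (A01 a) (A01 (f a)) (dZ a) (dZ (f a)) => /implyP + /implyP + /implyP + /implyP.
have h' : A1 a && ~~ A0 a ==> ~~ Z (f a) by apply/implyP => /andP[/h].
have := h (f a); rewrite fK => {}h.
have : A1 (f a) && ~~ A0 (f a) ==> ~~ Z a by apply/implyP => /andP[/h].
move: h'.
by case: (A0 a); case: (A0 (f a)); case: (A1 a); case: (A1 (f a));
  case: (Z a); case: (Z (f a)).
Qed.

End Inner.

(** * Resolving a crossing by conjugation with a transposition *)

Section Uncross.
Variable T : finType.
Implicit Types (f g : T -> T) (P : pred T).

(** Conjugation by [t] replaces the arcs at [c1] and [c2] by one joining [c1] to [c2] and one
    joining [g c1] to [g c2]; the other arcs are untouched. *)
Lemma inner_conj g P c1 c2 : involutive g -> (forall a, g a != a) ->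
  uniq [:: c1; g c1; c2; g c2] ->
  let t := tperm c1 (g c2) in
  (inner (fun a => t (g (t a))) P + (P c1 && P (g c1)).*2 + (P c2 && P (g c2)).*2 =
   inner g P + (P c1 && P c2).*2 + (P (g c1) && P (g c2)).*2)%N.
Proof.
move=> gK gN u t.
have -> : inner (fun a => t (g (t a))) P = (\sum_a (P (t a) && P (t (g a))))%N.
  rewrite /inner (reindex_inj (@perm_inj _ t)) /=; apply: eq_bigr => a _.
  by rewrite tpermK (inj_eq perm_inj) gN.
have -> : inner g P = (\sum_a (P a && P (g a)))%N.
  by apply: eq_bigr => a _; rewrite gN.
set s := [:: c1; g c1; c2; g c2] in u.
rewrite (bigID (mem s)) /= [in RHS](bigID (mem s)) /=.
have -> : (\sum_(i | i \notin s) (P (t i) && P (t (g i))) =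
  \sum_(i | i \notin s) (P i && P (g i)))%N.
  apply: eq_bigr => a; rewrite !inE !negb_or => /and4P[n1 n2 n3 n4].
  rewrite !tpermD // 1?eq_sym //.
    by rewrite (can2_eq gK gK).
  by rewrite (inj_eq (can_inj gK)).
rewrite -!(big_uniq _ u) /= !big_cons !big_nil /= !gK.
have [t1 t2] : t c1 = g c2 /\ t (g c2) = c1 by rewrite tpermL tpermR.
have t3 : t (g c1) = g c1 /\ t c2 = c2.
  move: u; rewrite /= !inE !negb_or => /and4P[/and3P[n1 n2 n3] /andP[n4 n5] n6 _].
  by rewrite !tpermD // 1?eq_sym //.
rewrite t1 t2 t3.1 t3.2.
by case: (P c1); case: (P c2); case: (P (g c1)); case: (P (g c2)); rewrite /=; lia.
Qed.

End Uncross.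

Section Key.
Variables (T : finType) (f g : T -> T) (pos : T -> nat).
Hypotheses (fK : involutive f) (gK : involutive g).
Hypotheses (fN : forall a, f a != a) (gN : forall a, g a != a).
Hypothesis pos_inj : injective pos.
Let I x y : pred T := fun a => (x <= pos a < y)%N.
Hypothesis leI : forall x y, (inner g (I x y) <= inner f (I x y))%N.

(* The interval [0, J.+2) is minimal for inclusion with more arcs of [f]
   than of [g]; it contains [i] and [f i], hence the [.+2]. *)
Lemma uncross_min i J :
  pos i = 0%N ->
  (inner g (I 0 J.+2) < inner f (I 0 J.+2))%N ->
  (inner g (I 1 J.+2) = inner f (I 1 J.+2))%N ->
  (inner g (I 0 J.+1) = inner f (I 0 J.+1))%N ->
  (inner g (I 1 J.+1) = inner f (I 1 J.+1))%N ->
  exists c, let t := tperm c (g i) in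
    [/\ (pos i < pos c)%N, (pos c < pos (g i))%N, (pos (g i) < pos (g c))%N &
     forall x y, (inner g (I x y) <= inner (fun a =>
       t (g (t a))) (I x y) <= inner f (I x y))%N].
Proof.
move=> i0 lt0 e1 e2 e3.
have U1 h y : involutive h -> (0 < y)%N ->
  inner h (I 0 y) = (inner h (I 1 y) + (I 1 y (h i)).*2)%N.
  move=> hK y0; apply: inner_setU1 => //; first by rewrite /I i0.
  move=> a; rewrite /I; case: (eqVneq a i) => [->|]; first by rewrite i0.
  by rewrite -(inj_eq pos_inj) i0 /=; case: (pos a).
have fi1 : (0 < pos (f i))%N by rewrite lt0n -i0 (inj_eq pos_inj) fN.
have gi1 : (0 < pos (g i))%N by rewrite lt0n -i0 (inj_eq pos_inj) gN.
(* Without [i] the counts agree, so the excess is the arc of [f] at [i]: it ends at the last point,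
   while the arc of [g] at [i] ends beyond it. *)
move: (lt0) (e2); rewrite !U1 // e1 e3 /I fi1 gi1 /= => hlt he.
have {hlt he} [fij gij] : pos (f i) = J.+1 /\ (J.+2 <= pos (g i))%N by lia.
have J0 : (0 < J.+1)%N by [].
pose j := f i.
have U2 h : involutive h -> inner h (I 0 J.+2) =
  (inner h (I 0 J.+1) + (I 0 J.+1 (h j)).*2)%N.
  move=> hK; apply: inner_setU1 => //; first by rewrite /I fij ltnn.
  move=> a; rewrite /I -(inj_eq pos_inj) fij; lia.
(* Deleting the last point [j] instead shows that the arc of [g] at [j] leaves the interval too. *)
have gj : (J.+2 <= pos (g j))%N.
  move: lt0; rewrite !U2 // e2 /I fK i0 /= => hlt.
  have : pos (g j) != J.+1 by rewrite -fij (inj_eq pos_inj) gN.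
  lia.
(* Such an interval contains the arc of [f] at [i] but not that of [g]; a surplus of 2 is one
   arc. *)
have D0 y : (J.+2 <= y <= pos (g i))%N -> (inner g (I 0 y) + 2 <= inner f (I 0 y))%N.
  move=> yP; rewrite !U1 //; try lia.
  have := leI 1 y; rewrite /I fij gi1 /=; lia.
pose C : pred T := fun a => (J < pos a < pos (g i))%N.
have Cj : C j by rewrite /C fij; lia.
(* With [g c] as far as possible, the arcs of [g] starting in [J.+1, y) end
   before [z] below, so that the count of [g] is modular there. *)
case: (arg_maxnP (fun a => pos (g a)) Cj) => c Cc cmax.
have hc : (J.+2 <= pos (g c))%N by apply: leq_trans gj (cmax _ Cj).
have claim y z : (J.+2 <= y <= pos (g i))%N -> (y <= z)%N -> (pos (g c) < z)%N ->
    (inner g (I y z) + 2 <= inner f (I y z))%N.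
  move=> yP yz hz.
  (* The complement of [[x, z)] is [[0, x)] together with [Z]. Via [innerC], supermodularity for [f]
     against modularity for [g] carries the surplus from [[0, y)] to [[y, z)]. *)
  pose Z : pred T := fun a => (z <= pos a)%N.
  have CE x : (x <= z)%N -> forall h, inner h (predU (I 0 x) Z) = inner h (predC (I x z)).
    by move=> xz h; apply: eq_inner => a; rewrite /I /Z /=; lia.
  have S : subpred (I 0 J.+1) (I 0 y) by move=> a; rewrite /I; lia.
  have dZ : forall a, I 0 y a -> ~~ Z a by move=> a; rewrite /I /Z; lia.
  have := inner_supermod f S dZ.
  have := inner_modular gK S dZ.
  rewrite !CE //; [| lia | lia].
  have/= c1 := innerC (I y z) gK gN; have/= c2 := innerC (I y z) fK fN.
  have/= c3 := innerC (I J.+1 z) gK gN; have/= c4 := innerC (I J.+1 z) fK fN.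
  have := D0 _ yP; have := leI J.+1 z.
  move=> d1 d2 m1 m2.
  have {}m1 : (inner g (predC (I J.+1 z)) + inner g (I 0 y) =
    inner g (predC (I y z)) + inner g (I 0 J.+1))%N.
    apply: m1 => a; rewrite /I /Z => ay aJ.
    have /cmax : C a by rewrite /C; lia.
    lia.
  lia.
(* If [g c] came before [g i], [claim] would give [f] an arc inside a single point. *)
have hgi : (pos (g i) < pos (g c))%N.
  rewrite ltnNge leq_eqVlt (inj_eq pos_inj) (inj_eq (can_inj gK));
    apply/negP => /orP[/eqP ci|hlt].
    by move: Cc; rewrite ci /C i0.
  have := claim (pos (g c)) (pos (g c)).+1;
    rewrite hc (ltnW hlt) leqnSn ltnSn => /(_ isT isT isT).
  suff -> : inner f (I (pos (g c)) (pos (g c)).+1) = 0%N by lia.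
  rewrite /inner big1 // => a _; rewrite /I.
  have : pos (f a) != pos a by rewrite (inj_eq pos_inj) fN.
  rewrite (inj_eq pos_inj) fN /=; have := fN a; rewrite -(inj_eq pos_inj); lia.
have /andP[c1 c2] := Cc.
exists c; set t := tperm c (g i); split; [by rewrite i0; lia|lia|lia|] => x y.
have u : uniq [:: c; g c; i; g i].
  rewrite /= !inE -!(inj_eq pos_inj) i0; lia.
rewrite -/(I x y).
(* Resolving raises the count only on intervals containing [i] and [c] but not [g i], or [g i] and
   [g c] but not [c]; on both kinds [f] has an arc to spare. *)
have D : (((x == 0) && (pos c < y <= pos (g i))) || (pos c < x <=
  pos (g i)) && (pos (g c) < y))%N ->
    (inner g (I x y) + 2 <= inner f (I x y))%N.
  case/orP => [/andP[/eqP -> yP]|/andP[xP yP]]; first by apply: D0; lia.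
  by apply: claim; lia.
have /= := inner_conj (I x y) gK gN u; rewrite -/t.
move: D (leI x y); move: (inner (fun _ => _) _) => G1.
move: (inner _ _) (inner _ _) => G2 G3.
rewrite /I i0; lia.
Qed.

End Key.

(** * The order on involutions of an interval *)

Definition itv n (x y : nat) : pred 'I_n := fun a => (x <= a < y)%N.
Arguments itv {n}.

Definition inner_le n (g f : 'I_n -> 'I_n) :=
  forall x y, (inner g (itv x y) <= inner f (itv x y))%N.

Section Linear.
Variable n : nat.
Implicit Types (f g : 'I_n -> 'I_n).

Lemma inner_itvS f (i : 'I_n) y : involutive f -> (i < y)%N ->
  inner f (itv i y) = (inner f (itv i.+1 y) + (itv i.+1 y (f i)).*2)%N.
Proof.
move=> fK iy; apply: inner_setU1 => //; first by rewrite /itv ltnn.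
by move=> a; rewrite /itv -val_eqE /=; lia.
Qed.

(** Dropping the first point [i] of an interval [[i, y)] tells whether the partner of [i] lies to
    its right and before [y]. This locates every right end; the points not on an arc are fixed. *)
Lemma inner_itv_inj f g : involutive f -> involutive g ->
  (forall x y, (y <= n)%N -> inner f (itv x y) = inner g (itv x y)) -> f =1 g.
Proof.
move=> fK gK e.
have E (i : 'I_n) y : (i < y <= n)%N -> (i < f i < y)%N = (i < g i < y)%N.
  move=> iy; have := e i y; rewrite !inner_itvS //; try lia.
  by rewrite e /itv; lia.
have E2 (i : 'I_n) : (i < f i)%N || (i < g i)%N -> f i = g i.
  have := ltn_ord (f i); have := ltn_ord (g i).
  move=> h1 h2 h; apply: ord_inj.
  have := E i (f i).+1; have := E i (g i).+1.
  have := E i (f i); have := E i (g i); lia.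
move=> i; case: (boolP ((i < f i) || (i < g i))%N) => [/E2//|].
rewrite negb_or -!leqNgt => /andP[h1 h2].
case: (ltnP (f i) i) => h3.
  by have := E2 (f i); rewrite fK h3 => /(_ isT) e'; apply: (can_inj gK); rewrite gK.
case: (ltnP (g i) i) => h4.
  by have := E2 (g i); rewrite gK h4 orbT => /(_ isT) e'; apply: (can_inj fK); rewrite fK.
by apply: ord_inj; lia.
Qed.

(* The position of [a] on a circle cut just before [i]. *)
Definition rot_pos (i a : 'I_n) : nat := if (a < i)%N then (a + n - i)%N else (a - i)%N.

Lemma rot_pos_inj i : injective (rot_pos i).
Proof.
move=> a b; rewrite /rot_pos => h; apply: ord_inj.
move: h; have := ltn_ord i; have := ltn_ord a; have := ltn_ord b.
by case: ifP; case: ifP; lia.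
Qed.

Lemma rot_pos_lt i a : (rot_pos i a < n)%N.
Proof. by rewrite /rot_pos; have := ltn_ord i; have := ltn_ord a; case: ifP; lia. Qed.

Lemma rot_posi i : rot_pos i i = 0%N.
Proof. by rewrite /rot_pos ltnn subnn. Qed.

(** An interval of rotated positions is a circular arc; when it wraps around the end of the line it
    is the complement of an interval. *)
Lemma rot_itv i x y : exists x' y',
  (fun a => (x <= rot_pos i a < y)%N) =1 itv x' y' \/
  (fun a => (x <= rot_pos i a < y)%N) =1 predC (itv x' y').
Proof.
have := ltn_ord i => hi.
wlog : y / (y <= n)%N.
  move=> hw; case: (leqP y n) => yn; first exact: hw.
  case: (hw n (leqnn n)) => x' [y' h]; exists x', y'.
  case: h => h; [left|right] => a; rewrite -h; have := rot_pos_lt i a; lia.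
move=> yn.
case: (leqP (y + i) n) => h1.
  exists (x + i)%N, (y + i)%N; left => a; rewrite /itv /rot_pos.
  by have := ltn_ord a; case: ifP; lia.
case: (leqP n (x + i)) => h2.
  exists (x + i - n)%N, (y + i - n)%N; left => a; rewrite /itv /rot_pos.
  by have := ltn_ord a; case: ifP; lia.
exists (y + i - n)%N, (x + i)%N; right => a; rewrite /itv /rot_pos /=.
by have := ltn_ord a; case: ifP; lia.
Qed.

Lemma itv_rot i x y : (y <= n)%N -> exists x' y',
  (itv x y) =1 (fun a => (x' <= rot_pos i a < y')%N) \/
  (itv x y) =1 predC (fun a => (x' <= rot_pos i a < y')%N).
Proof.
have := ltn_ord i => hi yn.
case: (leqP i x) => h1.
  exists (x - i)%N, (y - i)%N; left => a; rewrite /itv /rot_pos.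
  by have := ltn_ord a; case: ifP; lia.
case: (leqP y i) => h2.
  exists (x + n - i)%N, (y + n - i)%N; left => a; rewrite /itv /rot_pos.
  by have := ltn_ord a; case: ifP; lia.
exists (y - i)%N, (x + n - i)%N; right => a; rewrite /itv /rot_pos /=.
by have := ltn_ord a; case: ifP; lia.
Qed.

Lemma innerC_le f g (P : pred 'I_n) : involutive f -> involutive g ->
  (forall a, f a != a) -> (forall a, g a != a) ->
  (inner g (predC P) <= inner f (predC P))%N = (inner g P <= inner f P)%N.
Proof.
move=> fK gK fN gN; move: (innerC P fK fN) (innerC P gK gN).
by move: (inner _ _) (inner _ _) (inner _ _) (inner _ _) #|_| (\sum_a _)%N; lia.
Qed.

Lemma inner_le_rot f g i : involutive f -> involutive g ->
  (forall a, f a != a) -> (forall a, g a != a) ->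
  (forall x y, inner g (fun a => x <= rot_pos i a < y) <=
               inner f (fun a => x <= rot_pos i a < y))%N <->
  inner_le g f.
Proof.
move=> fK gK fN gN; split=> h x y.
  wlog yn : y / (y <= n)%N.
    move=> hw; case: (leqP y n) => yn; first exact: hw.
    have e : itv x y =1 (itv x n : pred 'I_n) by move=> a; rewrite /itv;
      have := ltn_ord a; lia.
    by rewrite !(eq_inner _ e); apply: hw.
  have [x' [y' [e|e]]] := itv_rot i x yn; rewrite !(eq_inner _ e) ?innerC_le //; exact: h.
have [x' [y' [e|e]]] := rot_itv i x y; rewrite !(eq_inner _ e) ?innerC_le //; exact: h.
Qed.

Lemma uncross f g : involutive f -> involutive g ->
  (forall a, f a != a) -> (forall a, g a != a) ->
  inner_le g f -> ~ g =1 f ->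
  exists i c, let p := rot_pos i in let t := tperm c (g i) in
    let h a := t (g (t a)) in
    [/\ (p i < p c)%N, (p c < p (g i))%N, (p (g i) < p (g c))%N,
      inner_le g h & inner_le h f].
Proof.
move=> fK gK fN gN gf gNf.
(* The type ['I_n.+1] allows the endpoint [n], which half-open intervals require. *)
pose bad (p : 'I_n.+1 * 'I_n.+1) := (inner g (itv p.1 p.2) < inner f (itv p.1 p.2))%N.
have [p0 bad0] : exists p, bad p.
  case: (boolP [exists p, bad p]) => [/existsP //|/existsPn nbad].
  case: gNf => a; apply/esym; move: a; apply: inner_itv_inj => // x y yn.
  apply/eqP; rewrite eqn_leq gf andbT.
  case: (ltnP n x) => xn.
    by rewrite /inner big1 // => a _; rewrite /itv; lia.
  by have := nbad (inord x, inord y); rewrite /bad /= !inordK // -leqNgt.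
case: (arg_minnP (fun p : 'I_n.+1 * 'I_n.+1 => p.2 - p.1)%N bad0) => [[x y]];
  rewrite /bad /= => xy_bad xy_min.
have min x' y' : (y' <= n)%N -> (y' - x' < y - x)%N ->
  inner g (itv x' y') = inner f (itv x' y').
  move=> yn h; apply/eqP; rewrite eqn_leq gf leqNgt; apply/negP => h2.
  case: (ltnP n x') => xn.
    by move: h2; rewrite {2}/inner big1 // => a _; rewrite /itv; lia.
  have := xy_min (inord x', inord y'); rewrite /= !inordK // => /(_ h2); lia.
have xy1 : (x.+1 < y)%N.
  rewrite ltnNge; apply/negP => yx; move: xy_bad; rewrite {2}/inner big1 // => a _.
  have := fN a; rewrite -val_eqE /itv /=; lia.
have := ltn_ord y => yn; rewrite ltnS in yn.
have xn : (x < n)%N by lia.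
pose i := Ordinal xn; have yi : (y <= n)%N by lia.
(* Cut at [x], the first [y - x] positions are those of the points of [[x, y)], so nothing wraps
   around. *)
have IE u v h : (v <= y - x)%N ->
  inner h (fun a => u <= rot_pos i a < v)%N = inner h (itv (x + u) (x + v)).
  move=> vy; apply: eq_inner => a; rewrite /rot_pos /itv /=; have := ltn_ord a;
    case: ifP; lia.
have J2 : (y - x - 2).+2 = (y - x)%N by lia.
have le1 := (inner_le_rot i fK gK fN gN).2 gf.
have [] := @uncross_min _ f g (rot_pos i) fK gK fN gN (@rot_pos_inj i) le1 i (y - x - 2).
- exact: rot_posi.
- by rewrite !IE //; [|lia|lia]; rewrite J2 addn0 subnKC //; lia.
- by rewrite !IE //; [|lia|lia]; apply: min; lia.
- by rewrite !IE //; [|lia|lia]; apply: min; lia.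
- by rewrite !IE //; [|lia|lia]; apply: min; lia.
move=> c [c1 c2 c3 H]; exists i, c; set t := tperm c (g i).
have hK : involutive (fun a => t (g (t a))) by move=> a; rewrite tpermK gK tpermK.
have hN a : t (g (t a)) != a by rewrite (can2_eq (tpermK _ _) (tpermK _ _)) gN.
split=> //.
  by apply/(inner_le_rot i) => // u v; case/andP: (H u v).
by apply/(inner_le_rot i) => // u v; case/andP: (H u v).
Qed.
End Linear.

(** * Doubling the line to remove fixed points *)

Section Double.
Variable n : nat.
Implicit Types (f g : 'I_n -> 'I_n).

Definition dbl f (z : 'I_(n + n)) : 'I_(n + n) :=
  match split z with
  | inl x => if f x == x then rshift n x else lshift n (f x)
  | inr x => if f x == x then lshift n x else rshift n (f x)
  end.

Lemma dbl_lshift f x : dbl f (lshift n x) = if f x == x then rshift n x else lshift n (f x).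
Proof. by rewrite /dbl (unsplitK (inl x)). Qed.

Lemma dbl_rshift f x : dbl f (rshift n x) = if f x == x then lshift n x else rshift n (f x).
Proof. by rewrite /dbl (unsplitK (inr x)). Qed.

Lemma dblK f : involutive f -> involutive (dbl f).
Proof.
move=> fK z; rewrite -(splitK z); case: (split z) => x /=.
  rewrite dbl_lshift; case: eqP => fx; first by rewrite dbl_rshift fx eqxx.
  by rewrite dbl_lshift fK; case: eqP => // e; case: fx.
rewrite dbl_rshift; case: eqP => fx; first by rewrite dbl_lshift fx eqxx.
by rewrite dbl_rshift fK; case: eqP => // e; case: fx.
Qed.

Lemma dbl_neq f z : dbl f z != z.
Proof.
rewrite -(splitK z); case: (split z) => x /=; rewrite ?dbl_lshift ?dbl_rshift.
  by case: ifP => fx; rewrite ?eq_rlshift ?(inj_eq (@lshift_inj _ _)) ?fx.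
by case: ifP => fx; rewrite ?eq_lrshift ?(inj_eq (@rshift_inj _ _)) ?fx.
Qed.

Lemma inner_dbl f (P : pred 'I_(n + n)) :
  (forall x, ~~ (P (lshift n x) && P (rshift n x))) ->
  inner (dbl f) P =
  (inner f (fun x => P (lshift n x)) + inner f (fun x => P (rshift n x)))%N.
Proof.
move=> dP; rewrite /inner big_split_ord /=.
congr (_ + _)%N; apply: eq_bigr => x _; rewrite dbl_neq ?dbl_lshift ?dbl_rshift /=.
  by case: eqP => //= _; rewrite (negbTE (dP x)).
by case: eqP => //= _; rewrite andbC (negbTE (dP x)).
Qed.

(** An interval of length at most [n] never contains a point with its copy, so it only sees an
    interval of each half; for a longer one the same is true of its complement. *)
Lemma inner_le_dbl f g : involutive f -> involutive g -> inner_le g f ->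
  inner_le (dbl g) (dbl f).
Proof.
move=> fK gK gf.
have leP (P : pred 'I_n) x y : P =1 itv x y -> (inner g P <= inner f P)%N.
  by move=> e; rewrite !(eq_inner _ e).
have small x y : (y <= x + n)%N -> (inner (dbl g) (itv x y) <= inner (dbl f) (itv x y))%N.
  move=> yx; rewrite !inner_dbl; try by move=> a; rewrite /itv /=; lia.
  apply: leq_add.
    by apply: (@leP _ x y) => a; rewrite /itv.
  by apply: (@leP _ (x - n) (y - n))%N => a; rewrite /itv /=; lia.
move=> x y; wlog yn : y / (y <= n + n)%N.
  move=> hw; case: (leqP y (n + n)) => yn; first exact: hw.
  have e : itv x y =1 (itv x (n + n) : pred 'I_(n + n)).
    by move=> a; rewrite /itv; have := ltn_ord a; lia.
  by rewrite !(eq_inner _ e); apply: hw.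
case: (leqP y (x + n)) => [|xy]; first exact: small.
rewrite -innerC_le; try exact: dblK; try exact: dbl_neq.
rewrite !inner_dbl; try by move=> a; rewrite /itv /=; have := ltn_ord a; lia.
apply: leq_add.
  by apply: (@leP _ 0 x) => a; rewrite /itv /=; have := ltn_ord a; lia.
by apply: (@leP _ (y - n) n)%N => a; rewrite /itv /=; have := ltn_ord a; lia.
Qed.

End Double.

(** * Resolutions as permutations, and a measure for the induction *)

Section Perms.
Variable n : nat.
Implicit Types (s u v : 'S_n).

(* The two resolutions of a crossing: nested arcs, or disjoint ones. *)
Definition uncrossing u v := exists a b c d : 'I_n,
  [/\ (a < b < c)%N && (c < d)%N, u a = c /\ u b = d,
      v a = d /\ v b = c \/ v a = b /\ v c = d &
      forall x, x \notin [:: a; b; c; d] -> v x = u x].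

(** The resolution is the conjugate of [u] by a transposition, hence again an involution without
    fixed points. *)
Lemma uncross_perm s u : involutive s -> involutive u ->
  (forall a, s a != a) -> (forall a, u a != a) ->
  inner_le u s -> u != s ->
  exists v, [/\ involutive v, forall a, v a != a, inner_le u v,
    inner_le v s & v != u /\ uncrossing u v].
Proof.
move=> sK uK sN uN us /eqP neq.
have neq' : ~ u =1 s by move=> e; apply: neq; apply/permP.
have [i [c]] := uncross sK uK sN uN us neq'.
set p := rot_pos i => /=; set t := tperm c (u i) => - [p1 p2 p3 uv vs].
have vE x : (u ^ t)%g x = t (u (t x)) by rewrite -{1}(tpermK c (u i) x) permJ.
have vK : involutive (u ^ t)%g by move=> x; rewrite !vE tpermK uK tpermK.
have vN a : (u ^ t)%g a != a by rewrite vE (can2_eq (tpermK _ _) (tpermK _ _)) uN.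
have pn a b : (p a < p b)%N -> b != a by apply: contraTneq => ->; rewrite ltnn.
have n1 : c != i by exact: pn.
have n2 : u i != c by exact: pn.
have n3 : u c != u i by exact: pn.
have n4 : u c != c by exact: uN.
have n5 : u i != i by exact: uN.
have n6 : u c != i by rewrite (can2_eq uK uK) eq_sym.
have ti : t i = i by rewrite tpermD.
have tuc : t (u c) = u c by rewrite tpermD // eq_sym.
have v1 : (u ^ t)%g i = c by rewrite vE ti tpermR.
have v2 : (u ^ t)%g c = i by rewrite vE tpermL uK ti.
have v3 : (u ^ t)%g (u i) = u c by rewrite vE tpermR tuc.
have v4 : (u ^ t)%g (u c) = u i by rewrite -v3 vK.
have vx x : x \notin [:: i; c; u i; u c] -> (u ^ t)%g x = u x.
  rewrite !inE !negb_or => /and4P[x1 x2 x3 x4]; rewrite vE !tpermD // 1?eq_sym //.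
    by rewrite (can2_eq uK uK).
  by rewrite (inj_eq perm_inj).
exists (u ^ t)%g; split => //.
- by move=> x y; have := uv x y; congr (_ <= _)%N; apply: eq_bigr => a _; rewrite !vE.
- by move=> x y; have := vs x y; congr (_ <= _)%N; apply: eq_bigr => a _; rewrite !vE.
split; first by apply/eqP => /permP /(_ i); rewrite v1; move/eqP;
  rewrite eq_sym (negbTE n2).
have perm_vx q : perm_eq q [:: i; c; u i; u c] -> forall x, x \notin q -> (u ^ t)%g x = u x.
  by move=> /perm_mem e x; rewrite e; apply: vx.
have rot1 (m : nat) : perm_eq (rot m [:: i; c; u i; u c]) [:: i; c; u i; u c].
  by rewrite perm_rot.
(* The order of [i], [c], [u i], [u c] on the line depends on the place of the
   cut between the four points. *)
move: p1 p2 p3; rewrite /p /rot_pos ltnn subnn.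
have ui := uK i; have uc := uK c.
case: (ltnP c i) => h1 p1; last first.
  case: (ltnP (u i) i) => h2; last first.
    case: (ltnP (u c) i) => h3 h4 h5; last first.
      exists i, c, (u i), (u c); split; [lia|by []|by right|exact: vx].
    exists (u c), i, c, (u i); split; [lia|by []|by left|exact: (perm_vx _ (rot1 3))].
  case: (ltnP (u c) i) => h3 h4 h5; last by have := ltn_ord (u c); lia.
  exists (u i), (u c), i, c; split; [lia|by []|by right|exact: (perm_vx _ (rot1 2))].
case: (ltnP (u i) i) => h2; last by have := ltn_ord (u i); lia.
case: (ltnP (u c) i) => h3 h4 h5; last by have := ltn_ord (u c); lia.
exists c, (u i), (u c), i; split; [lia|by []|by left|exact: (perm_vx _ (rot1 1))].
Qed.

(** Measure for the induction on degenerations: it grows strictly along the order because the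
    interval counts determine an involution. *)
Definition inner_total s : nat := \sum_(x < n.+1) \sum_(y < n.+1) inner s (itv x y).

Lemma inner_total_lt u v : involutive u -> involutive v -> inner_le u v -> v != u ->
  (inner_total u < inner_total v)%N.
Proof.
move=> uK vK uv; apply: contraNltn => le.
apply/eqP/permP; apply: inner_itv_inj => // x y yn.
apply/eqP; rewrite eqn_leq uv andbT.
case: (ltnP n x) => xn; first by rewrite /inner big1 // => a _; rewrite /itv; lia.
have e (w : 'S_n) : (inner_total w = inner w (itv x y) +
   (\sum_(j < n.+1 | j != inord y) inner w (itv x j) +
     \sum_(i < n.+1 | i != inord x) \sum_(j < n.+1) inner w (itv i j)))%N.
  by rewrite /inner_total (bigD1 (inord x)) //= (bigD1 (inord y)) //= !inordK // addnA.
have h1 : (\sum_(j < n.+1 | j != inord y) inner u (itv x j) <=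
  \sum_(j < n.+1 | j != inord y) inner v (itv x j))%N.
  by apply: leq_sum => j _; apply: uv.
have h2 : (\sum_(i < n.+1 | i != inord x) \sum_(j < n.+1) inner u (itv i j) <=
  \sum_(i < n.+1 | i != inord x) \sum_(j < n.+1) inner v (itv i j))%N.
  by apply: leq_sum => i _; apply: leq_sum => j _; apply: uv.
rewrite leqNgt; apply/negP => lt; move: le; rewrite leqNgt !e => /negP; apply.
by rewrite -addSn leq_add // leq_add.
Qed.

End Perms.

Import GRing.Theory Num.Theory.
Local Open Scope classical_set_scope.
Local Open Scope ring_scope.

(** * The Borel group and Zariski closures *)

Section Borel.
Variables (F : fieldType) (n : nat).
Implicit Types (A B u v : 'M[F]_n).

Lemma det_upper A : (forall i j : 'I_n, (j < i)%N -> A i j = 0) -> \det A = \prod_i A i i.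
Proof.
move=> A0; rewrite -det_tr det_trig; first by apply: eq_bigr => i _; rewrite mxE.
by apply/is_trig_mxP => i j ij; rewrite mxE A0.
Qed.

Lemma borel_intro A : (forall i j : 'I_n, (j < i)%N -> A i j = 0) ->
  (forall i, A i i != 0) -> borel_group A.
Proof.
move=> A0 Ad; split=> //; rewrite unitmxE det_upper // unitfE.
by apply/prodf_neq0 => i _; exact: Ad.
Qed.

Lemma borel_diag_neq0 A i : borel_group A -> A i i != 0.
Proof.
case=> + A0; rewrite unitmxE det_upper // unitfE => /prodf_neq0; exact.
Qed.

Lemma borel_inv A : borel_group A -> borel_group (invmx A).
Proof.
move=> hA; have [uA A0] := hA; split; first by rewrite unitmx_inv.
(* Back substitution from the last row upward: in row [i] of [A *m invmx A] only the term with
   [A i i] survives. *)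
suff h k (i j : 'I_n) : (n - i <= k)%N -> (j < i)%N -> invmx A i j = 0 by move=> i j;
  apply: h.
elim: k i j => [|k IH] i j ik ji; first by have := ltn_ord i; lia.
have : (A *m invmx A) i j = 0.
  by rewrite mulmxV // mxE -val_eqE /= (gtn_eqF ji).
rewrite mxE (bigD1 i) //= big1 ?addr0.
  by move/eqP; rewrite mulf_eq0 (negbTE (borel_diag_neq0 _ hA)) => /eqP.
move=> l li; case: (ltnP l i) => h; first by rewrite A0 ?mul0r.
by rewrite (IH l) ?mulr0 //; move: li; rewrite -val_eqE /=; lia.
Qed.

Lemma borelM A B : borel_group A -> borel_group B -> borel_group (A *m B).
Proof.
case=> uA A0 [uB B0]; split; first by rewrite unitmx_mul uA.
move=> i j ji; rewrite mxE big1 // => k _.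
case: (ltnP k i) => h; first by rewrite A0 ?mul0r.
by rewrite B0 ?mulr0 //; apply: leq_trans ji h.
Qed.

Lemma borel1 : borel_group (1%:M : 'M[F]_n).
Proof. by apply: borel_intro => [i j ji|i];
  rewrite mxE ?eqxx ?oner_eq0 // -val_eqE /= (gtn_eqF ji). Qed.

(** Conjugacy stated without an inverse, so that it can be checked by expanding two products. *)
Definition bconj u v := exists2 A, borel_group A & A *m u = v *m A.

Lemma bconj_refl u : bconj u u.
Proof. by exists 1%:M; [exact: borel1|rewrite mul1mx mulmx1]. Qed.

Lemma bconj_trans u v w : bconj u v -> bconj v w -> bconj u w.
Proof.
move=> [A hA eA] [B hB eB]; exists (B *m A); first exact: borelM.
by rewrite -mulmxA eA mulmxA eB -mulmxA.
Qed.

Lemma bconjP A u v : borel_group A -> A *m u = v *m A <-> v = A *m u *m invmx A.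
Proof.
by case=> uA _; split=> [->|->]; rewrite ?mulmxK // mulmxKV.
Qed.

Lemma bconj_sym u v : bconj u v -> bconj v u.
Proof.
move=> [A hA e]; exists (invmx A); first exact: borel_inv.
by case: hA => uA _; rewrite -[u in RHS](mulKmx uA) e !mulmxA mulmxK.
Qed.

Lemma B_orbitE (s : 'S_n) u : B_orbit F s u <-> bconj (N_of F s) u.
Proof.
split=> [[A hA <-]|[A hA e]]; exists A => //; first exact/bconjP.
by apply/esym/bconjP.
Qed.

Lemma strictly_upperM A u : (forall i j : 'I_n, (j < i)%N -> A i j = 0) ->
  strictly_upper u -> strictly_upper (A *m u).
Proof.
move=> A0 u0 i j ji; rewrite mxE big1 // => k _.
case: (ltnP k i) => h; first by rewrite A0 ?mul0r.
by rewrite u0 ?mulr0 //; apply: leq_trans ji h.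
Qed.

Lemma strictly_upperMr A u : (forall i j : 'I_n, (j < i)%N -> A i j = 0) ->
  strictly_upper u -> strictly_upper (u *m A).
Proof.
move=> A0 u0 i j ji; rewrite mxE big1 // => k _.
case: (leqP k i) => h; first by rewrite u0 ?mul0r.
by rewrite A0 ?mulr0 //; apply: leq_ltn_trans ji h.
Qed.

Lemma bconj_upper u v : bconj u v -> strictly_upper u -> strictly_upper v.
Proof.
move=> [A hA /(bconjP _ _ hA) ->] u0; have [_ A0] := hA; have [_ B0] := borel_inv hA.
by apply: strictly_upperMr => //; apply: strictly_upperM.
Qed.

Lemma bconj_sq0 u v : bconj u v -> u *m u = 0 -> v *m v = 0.
Proof.
move=> [A hA /(bconjP _ _ hA) ->] u0; case: hA => uA _.
by rewrite !mulmxA mulmxKV // -(mulmxA A) u0 mulmx0 mul0mx.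
Qed.

Lemma N_of_upper (s : 'S_n) : strictly_upper (N_of F s).
Proof. by move=> i j ji; rewrite mxE ltnNge ji. Qed.

Lemma B_orbit_upper (s : 'S_n) : B_orbit F s `<=` strictly_upper (n := n).
Proof. by move=> u /B_orbitE /bconj_upper; apply; apply: N_of_upper. Qed.

Lemma B_orbit_refl (s : 'S_n) : B_orbit F s (N_of F s).
Proof. by apply/B_orbitE/bconj_refl. Qed.

End Borel.

(** * Zariski closure inside the strictly upper-triangular matrices *)

Section Closure.
Variable F : fieldType.

Lemma sub_zariski_closure n (Z : set 'M[F]_n) : Z `<=` zariski_closure Z.
Proof. exact: sub_gen_smallest. Qed.

(** Closed sets contain only strictly upper-triangular matrices; a [Z] with any other matrix would
    lie in no closed set, and its closure would be everything. *)
Lemma zariski_closureP n (Z : set 'M[F]_n) u : Z `<=` strictly_upper (n := n) ->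
  zariski_closure Z u <-> strictly_upper u /\
    forall p, (forall z, Z z -> p.@[coords z] = 0) -> p.@[coords u] = 0.
Proof.
move=> Zn; split=> [cu|[un h] C [[S ->] ZS]]; last first.
  by split=> // p Sp; apply: h => z /ZS[_]; apply.
pose S := [set p : {mpoly F[nvars n]} | forall z, Z z -> p.@[coords z] = 0].
have [] // := cu (zero_locus S).
split; first by exists S.
by move=> z Zz; split=> [|p]; [exact: Zn|apply].
Qed.

Lemma zariski_closure_upper n (Z : set 'M[F]_n) : Z `<=` strictly_upper (n := n) ->
  zariski_closure Z `<=` strictly_upper (n := n).
Proof. by move=> Zn u /(zariski_closureP _ Zn)[]. Qed.

Lemma zariski_closureS n (Z W : set 'M[F]_n) :
  W `<=` strictly_upper (n := n) -> Z `<=` zariski_closure W ->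
    zariski_closure Z `<=` zariski_closure W.
Proof.
move=> Wn ZW u cu.
have Zn : Z `<=` strictly_upper (n := n) by move=> z /ZW /(zariski_closure_upper Wn).
move: cu => /(zariski_closureP _ Zn)[un h]; apply/zariski_closureP => //; split=> // p hp.
by apply: h => z /ZW /(zariski_closureP _ Wn)[_]; apply.
Qed.

(** Polynomials pull back along linear maps. Rectangular [A] and [B] cover conjugation and also
    extraction of a corner block. *)
Lemma zariski_closure_mulmx n m (A : 'M[F]_(m, n)) (B : 'M[F]_(n,
  m)) (Z : set 'M[F]_n) (W : set 'M[F]_m) :
  Z `<=` strictly_upper (n := n) -> W `<=` strictly_upper (n := m) ->
  (forall u, strictly_upper u -> strictly_upper (A *m u *m B)) ->
  (forall u, Z u -> W (A *m u *m B)) ->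
  forall u, zariski_closure Z u -> zariski_closure W (A *m u *m B).
Proof.
move=> Zn Wn AB ZW u /(zariski_closureP _ Zn)[un h]; apply/zariski_closureP => //.
split; first exact: AB.
move=> p hp.
(* [lq] lists the entries of [A *m u *m B] above the diagonal as linear forms in the coordinates of
   [u]. *)
pose lq := [tuple \sum_a \sum_b (A (val (enum_val k)).1 a * B b (val (enum_val k)).2) *:
  x_ F b a | k < nvars m].
have lqE v : strictly_upper v -> (p \mPo lq).@[coords v] = p.@[coords (A *m v *m B)].
  move=> vn; rewrite comp_mpoly_meval; apply: meval_eq => k.
  rewrite tnth_mktuple raddf_sum /= [in RHS]/coords mxE.
  under [RHS]eq_bigr => b _ do rewrite mxE mulr_suml.
  rewrite [RHS]exchange_big /=.
  apply: eq_bigr => a _; rewrite raddf_sum /=; apply: eq_bigr => b _.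
  by rewrite mevalZ meval_x // mulrAC.
by rewrite -lqE //; apply: h => z Zz; rewrite lqE ?hp //; [exact: ZW|exact: Zn].
Qed.

End Closure.

(** * Limits along a line *)

Section Curve.
Variable F : numFieldType.

Lemma poly_eq0_cofin (p : {poly F}) : (forall t, t != 0 -> p.[t] = 0) -> p = 0.
Proof.
move=> h; apply/eqP; apply: contraT => p0.
(* These are [size p] nonzero roots, distinct in characteristic zero: more than the degree
   allows. *)
pose rs := [seq i.+1%:R : F | i <- iota 0 (size p)].
have := @max_poly_roots _ p rs p0; rewrite size_map size_iota ltnn; apply.
  by apply/allP => _ /mapP[i _ ->]; apply/rootP/h; rewrite pnatr_eq0.
by rewrite map_inj_uniq ?iota_uniq // => i j /eqP; rewrite eqr_nat eqSS => /eqP.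
Qed.

Lemma zariski_closure_line n (Z : set 'M[F]_n) u w :
  Z `<=` strictly_upper (n := n) -> strictly_upper u ->
  (forall t, t != 0 -> Z (u + t *: w)) -> zariski_closure Z u.
Proof.
move=> Zn un hZ; apply/zariski_closureP => //; split=> // p hp.
(* [P] is the restriction of [p] to the line, as a polynomial in [t]. *)
pose P : {poly F} := mmap polyC (fun k => (coords u k)%:P + coords w k *: 'X) p.
have PE t : P.[t] = p.@[coords (u + t *: w)].
  rewrite /P /mmap horner_sum; apply: eq_bigr => m _.
  rewrite hornerM hornerC; congr (_ * _).
  rewrite /mmap1 horner_prod; apply: eq_bigr => i _.
  by rewrite horner_exp !hornerE /coords !mxE mulrC.
have : P.[0] = 0 by rewrite (@poly_eq0_cofin P) ?horner0 // => t t0; rewrite PE hp //;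
  exact: hZ.
by rewrite PE scale0r addr0.
Qed.
End Curve.

(** * Degenerations *)

Section Degeneration.
Variables (F : numFieldType) (n : nat).
Implicit Types (s w u v : 'S_n) (a b c d : 'I_n).

(** When [q] is stable under [w], this is the matrix of the arcs avoiding [q]. *)
Definition N_out w (q : seq 'I_n) : 'M[F]_n :=
  \matrix_(i, j) [&& i \notin q, (i < j)%N & w i == j]%:R.

Lemma N_of_arcs w a b c d : uniq [:: a; b; c; d] -> involutive w ->
  (a < c)%N -> (b < d)%N -> w a = c -> w b = d ->
  N_of F w = N_out w [:: a; b; c; d] + delta_mx a c + delta_mx b d.
Proof.
rewrite /= !inE !negb_or => /and4P[/and3P[ab ac ad] /andP[bc bd] cd _] wK lac lbd wa wb.
have wc : w c = a by rewrite -wa wK.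
have wd : w d = b by rewrite -wb wK.
apply/matrixP => i j; rewrite !mxE !inE !negb_or.
case: (eqVneq i a) => [->|ia] /=.
  rewrite wa (negbTE ab) add0r addr0 [c == j]eq_sym.
  by case: eqP => [->|]; rewrite ?lac ?andbF.
case: (eqVneq i b) => [->|ib] /=.
  rewrite wb add0r add0r [d == j]eq_sym.
  by case: eqP => [->|]; rewrite ?lbd ?andbF.
rewrite !addr0.
case: (eqVneq i c) => [->|ic] /=.
  by rewrite wc; case: eqP => [<-|]; rewrite ?andbF // ltnNge ltnW.
case: (eqVneq i d) => [->|id] //=.
by rewrite wd; case: eqP => [<-|]; rewrite ?andbF // ltnNge ltnW.
Qed.

Lemma delta_N_out w q i j : j \in q -> delta_mx i j *m N_out w q = 0 :> 'M[F]_n.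
Proof.
move=> jq; apply/matrixP => x y; rewrite !mxE big1 // => z _; rewrite !mxE.
by case: (eqVneq z j) => [->|]; rewrite ?jq ?mulr0 // andbF mul0r.
Qed.

Lemma N_out_delta w q i j : involutive w -> i \in q -> {in q, forall x, w x \in q} ->
  N_out w q *m delta_mx i j = 0 :> 'M[F]_n.
Proof.
move=> wK iq wq; apply/matrixP => x y; rewrite !mxE big1 // => z _; rewrite !mxE.
case: (eqVneq z i) => [->|]; rewrite ?mulr0 //=.
case: (boolP (x \in q)) => //= xq; rewrite ?mul0r //.
case: eqP => [wx|]; rewrite ?andbF ?mul0r //.
by case/negP: xq; rewrite -(wK x) wx wq.
Qed.

Lemma eq_N_out w u q q' : q' =i q -> (forall x, x \notin q -> w x = u x) ->
  N_out w q' = N_out u q.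
Proof.
move=> qq' e; apply/matrixP => i j; rewrite !mxE qq'.
by case: (boolP (i \in q)) => //= iq; rewrite e.
Qed.

(** On a suitable line through [N_of F u] all other points are conjugate to [N_of F v]; the arcs
    outside the four points do not interact with the conjugating matrix. *)
Lemma uncrossing_degenerates u v : involutive u -> involutive v -> uncrossing u v ->
  zariski_closure (B_orbit F v) (N_of F u).
Proof.
move=> uK vK [a [b [c [d [lt_abcd [ua ub] va vx]]]]].
have ltab : (a < b)%N by lia.
have ltbc : (b < c)%N by lia.
have ltcd : (c < d)%N by lia.
have uq : uniq [:: a; b; c; d] by rewrite /= !inE -!val_eqE /=; lia.
have Nu := N_of_arcs uq uK (ltn_trans ltab ltbc) (ltn_trans ltbc ltcd) ua ub.
have [uc ud] : u c = a /\ u d = b by rewrite -ua -ub !uK.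
set q := [:: a; b; c; d] in vx Nu.
have uqq : {in q, forall x, u x \in q}.
  by move=> x; rewrite !inE => /or4P[] /eqP ->; rewrite ?ua ?ub ?uc ?ud eqxx ?orbT.
pose N0 := N_out u q.
have EN (i j : 'I_n) : j \in q -> delta_mx i j *m N0 = 0 :> 'M[F]_n by exact: delta_N_out.
have NE (i j : 'I_n) : i \in q -> N0 *m delta_mx i j = 0 :> 'M[F]_n by move=> ?;
  exact: N_out_delta.
have [aq bq cq dq] : [/\ a \in q, b \in q, c \in q & d \in q] by rewrite !inE !eqxx ?orbT.
have ne (x y : 'I_n) : (x < y)%N -> (x == y :> 'I_n) = false /\ (y == x :> 'I_n) = false.
  by move=> xy; rewrite -!val_eqE /= (gtn_eqF xy) (ltn_eqF xy).
have [ab ba] := ne _ _ ltab; have [bc cb] := ne _ _ ltbc; have [cd dc] := ne _ _ ltcd.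
have [ac ca] := ne _ _ (ltn_trans ltab ltbc); have [bd db] := ne _ _ (ltn_trans ltbc ltcd).
have ltad := ltn_trans ltab (ltn_trans ltbc ltcd); have [ad da] := ne _ _ ltad.
have nE := (ab, ba, bc, cb, cd, dc, ac, ca, bd, db, ad, da).
case: va => [[va vb]|[va vc]].
  have Nv : N_of F v = N0 + delta_mx a d + delta_mx b c.
    have uq' : uniq [:: a; b; d; c] by rewrite /= !inE !nE.
    rewrite (N_of_arcs uq' vK ltad ltbc va vb).
    congr (_ + _ + _); apply: eq_N_out => // x; rewrite !inE.
    by do 4!case: (x == _).
  apply: (@zariski_closure_line _ _ _ _ (delta_mx b c)); rewrite ?Nu //;
    first exact: B_orbit_upper.
    by rewrite -Nu; exact: N_of_upper.
  move=> t t0; apply/B_orbitE; rewrite Nv -/N0.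
  (* The diagonal is [t] at [b], [-t] at [d] and 1 elsewhere, hence invertible for nonzero [t]. *)
  exists (1%:M + delta_mx a b + (t - 1) *: delta_mx b b + delta_mx c d
    - (t + 1) *: delta_mx d d).
    apply: borel_intro => [i j ji|i]; rewrite !mxE.
      have -> : i == j = false by rewrite -val_eqE /= (gtn_eqF ji).
      have D (x y : 'I_n) : (x <= y)%N -> (i == x) && (j == y) = false.
        by move=> xy; apply/negbTE/andP => -[/eqP ei /eqP ej]; move: ji;
          rewrite ei ej ltnNge xy.
      by rewrite !D ?(ltnW ltab) ?(ltnW ltcd) // !mulr0 !addr0 subr0.
    rewrite eqxx; case: (eqVneq i a) => [->|_];
      first by rewrite ?nE /= ?nE !mulr0 !addr0 subr0 oner_eq0.
    case: (eqVneq i b) => [->|_];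
      first by rewrite ?nE /= ?nE !mulr0 mulr1 !addr0 subr0 addrC subrK.
    case: (eqVneq i c) => [->|_]; first by rewrite ?nE /= ?nE !mulr0 !addr0 subr0 oner_eq0.
    case: (eqVneq i d) => [_|_] /=; last by rewrite !mulr0 !addr0 subr0 oner_eq0.
    by rewrite mulr0 mulr1 !addr0 opprD addrCA subrr addr0 oppr_eq0.
  rewrite !(mulmxDl, mulmxDr, mulNmx, mulmxN) -!(scalemxAl, scalemxAr) !(EN, NE, mul1mx,
    mulmx1) //.
  rewrite !mul_delta_mx_cond ?eqxx ?nE !(mulr0n, mulr1n).
  clear Nv EN NE; clearbody N0; move: (delta_mx _ _) (delta_mx _ _) (delta_mx _ _)
    (delta_mx _ _) => *.
  by apply/matrixP => i j; rewrite !mxE; ring.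
have Nv : N_of F v = N0 + delta_mx a b + delta_mx c d.
  have uq' : uniq [:: a; c; b; d] by rewrite /= !inE !nE.
  rewrite (N_of_arcs uq' vK ltab ltcd va vc).
  congr (_ + _ + _); apply: eq_N_out => // x; rewrite !inE.
  by do 4!case: (x == _).
(* The opposite signs keep the square of the matrix zero along the line. *)
apply: (@zariski_closure_line _ _ _ _ (delta_mx a b - delta_mx c d)); rewrite ?Nu //;
  first exact: B_orbit_upper.
  by rewrite -Nu; exact: N_of_upper.
move=> t t0; apply/B_orbitE; rewrite Nv -/N0.
(* Here the diagonal is [t] at [a], [-t] at [c] and 1 elsewhere. *)
exists (1%:M + (t - 1) *: delta_mx a a - (t + 1) *: delta_mx c c + delta_mx b c).
  apply: borel_intro => [i j ji|i]; rewrite !mxE.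
    have -> : i == j = false by rewrite -val_eqE /= (gtn_eqF ji).
    have D (x y : 'I_n) : (x <= y)%N -> (i == x) && (j == y) = false.
      by move=> xy; apply/negbTE/andP => -[/eqP ei /eqP ej]; move: ji;
        rewrite ei ej ltnNge xy.
    by rewrite !D ?(ltnW ltbc) // !mulr0 !addr0 subr0.
  rewrite eqxx; case: (eqVneq i a) => [->|_];
    first by rewrite ?nE /= ?nE !mulr0 mulr1 subr0 addr0 addrC subrK.
  case: (eqVneq i b) => [->|_]; first by rewrite ?nE /= ?nE !mulr0 !addr0 subr0 oner_eq0.
  case: (eqVneq i c) => [_|_] /=; last by rewrite !mulr0 !addr0 subr0 oner_eq0.
  by rewrite mulr0 mulr1 !addr0 opprD addrCA subrr addr0 oppr_eq0.
rewrite !(mulmxDl, mulmxDr, mulNmx, mulmxN) -!(scalemxAl, scalemxAr) !(EN, NE, mul1mx,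
  mulmx1) //.
rewrite !(mulmxDl, mulNmx).
rewrite !mul_delta_mx_cond ?eqxx ?nE !(mulr0n, mulr1n).
clear Nv EN NE; clearbody N0; move: (delta_mx _ _) (delta_mx _ _) (delta_mx _ _)
  (delta_mx _ _) => *.
by apply/matrixP => i j; rewrite !mxE; ring.
Qed.

Lemma bconj_closure s (x y : 'M[F]_n) : bconj x y ->
  zariski_closure (B_orbit F s) x -> zariski_closure (B_orbit F s) y.
Proof.
move=> [A hA e]; have [uA A0] := hA; have [_ B0] := borel_inv hA.
move/(bconjP _ _ hA): e => ->.
apply: zariski_closure_mulmx => [||w w0|w]; try exact: B_orbit_upper.
  by apply: strictly_upperMr => //; apply: strictly_upperM.
move=> /B_orbitE sw; apply/B_orbitE; apply: bconj_trans sw _.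
by exists A => //; apply/bconjP.
Qed.

Lemma orbit_closure s u : zariski_closure (B_orbit F s) (N_of F u) ->
  B_orbit F u `<=` zariski_closure (B_orbit F s).
Proof. by move=> h w /B_orbitE /bconj_closure; apply. Qed.

(** Resolving a crossing of [u] gives a strictly larger [v] still below [s]; induction puts the
    orbit of [v] in the closure, which then contains [N_of F u]. *)
Lemma fpf_degenerates s u : involutive s -> involutive u ->
  (forall a, s a != a) -> (forall a, u a != a) -> inner_le u s ->
  zariski_closure (B_orbit F s) (N_of F u).
Proof.
move=> sK + sN.
have [k] := ubnP (inner_total s - inner_total u); elim: k u => // k IH u hk uK uN us.
case: (eqVneq u s) => [->|neq].
  by apply: sub_zariski_closure; apply: B_orbit_refl.
have [v [vK vN uv vs [vu hv]]] := uncross_perm sK uK sN uN us neq.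
have lt := inner_total_lt uK vK uv vu.
have le : (inner_total v <= inner_total s)%N.
  by apply: leq_sum => i _; apply: leq_sum => j _; apply: vs.
have := uncrossing_degenerates uK vK hv.
apply: zariski_closureS; first exact: B_orbit_upper.
by apply: orbit_closure; apply: IH => //; lia.
Qed.

End Degeneration.

Lemma ulsubmxM (F : fieldType) n (x y : 'M[F]_(n + n)) : dlsubmx y = 0 ->
  ulsubmx (x *m y) = ulsubmx x *m ulsubmx y.
Proof.
move=> y0; rewrite -{1}(submxK x) -{1}(submxK y) mulmx_block block_mxKul.
by rewrite y0 mulmx0 addr0.
Qed.

(** Truncation to the upper left block is multiplicative on upper-triangular matrices, so it maps
    the orbit of the doubled [s] into that of [s]. *)
Lemma inner_le_degenerates (F : numFieldType) n (s u : 'S_n) :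
  involutive s -> involutive u -> inner_le u s ->
  zariski_closure (B_orbit F s) (N_of F u).
Proof.
move=> sK uK us.
pose D (w : 'S_n) (wK : involutive w) := perm (can_inj (dblK wK)).
have DE (w : 'S_n) (wK : involutive w) : D w wK =1 dbl w by move=> x; rewrite permE.
have DK (w : 'S_n) (wK : involutive w) : involutive (D w wK) by move=> x; rewrite !DE dblK.
have DN (w : 'S_n) (wK : involutive w) a : D w wK a != a by rewrite DE dbl_neq.
pose A : 'M[F]_(n, n + n) := row_mx 1%:M 0.
pose B : 'M[F]_(n + n, n) := col_mx 1%:M 0.
have AB (x : 'M[F]_(n + n)) : A *m x *m B = ulsubmx x.
  rewrite -{1}(submxK x) /A /B mul_row_block !mul1mx !mul0mx !addr0.
  by rewrite mul_row_col mulmx1 mulmx0 addr0.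
(* An arc from a fixed point to its copy leaves the block, so truncation erases it. *)
have NE (w : 'S_n) (wK : involutive w) : ulsubmx (N_of F (D w wK)) = N_of F w.
  apply/matrixP => i j; rewrite !mxE DE dbl_lshift /=.
  case: (eqVneq (w i) i) => [wi|_]; last by rewrite (inj_eq (@lshift_inj _ _)).
  by rewrite eq_rlshift andbF wi; case: eqP => [->|]; rewrite ?ltnn ?andbF.
have dl0 (x : 'M[F]_(n + n)) : (forall i j : 'I_(n + n), (j < i)%N -> x i j = 0) ->
  dlsubmx x = 0.
  by move=> x0; apply/matrixP => i j; rewrite !mxE x0 //= ltn_addr.
have Nsup (x : 'M[F]_(n + n)) : strictly_upper x -> dlsubmx x = 0.
  by move=> x0; apply: dl0 => i j ji; apply/x0/ltnW.
rewrite -(NE u uK) -AB.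
have := @fpf_degenerates F _ _ _ (DK s sK) (DK u uK) (DN s sK) (DN u uK).
have le : inner_le (D u uK) (D s sK).
  move=> x y; have := inner_le_dbl sK uK us x y; congr (_ <= _)%N;
  by apply: eq_bigr => a _; rewrite !DE.
move=> /(_ le); apply: zariski_closure_mulmx => [||x x0|x].
- exact: B_orbit_upper.
- exact: B_orbit_upper.
- by rewrite AB => i j ji; rewrite !mxE x0.
move=> sx; have xup := B_orbit_upper sx; move/B_orbitE: sx => [g hg /(congr1 ulsubmx)].
have [_ g0] := hg.
rewrite !ulsubmxM ?NE => [e||]; [|exact: dl0|exact/Nsup/N_of_upper].
apply/B_orbitE; rewrite AB; exists (ulsubmx g) => //.
apply: borel_intro => [i j ji|i]; rewrite !mxE; first exact: g0.
exact: borel_diag_neq0.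
Qed.

(** * Classification of the orbits *)

Section Classification.
Variables (F : fieldType) (n : nat).
Implicit Types (u v A : 'M[F]_n) (s : 'S_n).

Definition normal_rows k s u := forall i j : 'I_n, (k <= i)%N -> u i j = N_of F s i j.

Lemma sum_N_of s (w : 'I_n -> F) (j : 'I_n) : involutive s ->
  \sum_a w a * N_of F s a j = (if (s j < j)%N then w (s j) else 0).
Proof.
move=> sK; rewrite (bigD1 (s j)) //= big1 ?addr0 => [|a ne].
  by rewrite mxE sK eqxx andbT; case: ifP; rewrite ?mulr1 ?mulr0.
rewrite mxE; case: eqP => [e|]; rewrite ?andbF ?mulr0 //.
by move: ne; rewrite -e sK eqxx.
Qed.

(** Below row [k], column [s j] has its only 1 in row [j], so the entry of [u *m u] at [(i, s j)] is
    [u i j]. *)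
Lemma sq0_row k s u (i j : 'I_n) : involutive s -> strictly_upper u -> u *m u = 0 ->
  normal_rows k.+1 s u -> i = k :> nat -> (j < s j)%N -> u i j = 0.
Proof.
move=> sK u0 uu hr ik js.
have := congr1 (fun x : 'M[F]_n => x i (s j)) uu; rewrite !mxE.
rewrite (eq_bigr (fun a => u i a * N_of F s a (s j))); first by rewrite sum_N_of // sK js.
move=> a _; case: (ltnP k a) => h; first by rewrite (hr a).
by rewrite u0 ?mul0r // ik.
Qed.

(** In row [i], the entries at left ends of arcs vanish since [u] squares to zero; those at right
    ends are cleared by adding the rows of the left ends. *)
Lemma clear_row k s u (i : 'I_n) : involutive s -> (forall a : 'I_n, (a <= k)%N ->
  s a = a) ->
  strictly_upper u -> u *m u = 0 -> normal_rows k.+1 s u -> i = k :> nat ->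
  exists v, [/\ bconj u v, normal_rows k.+1 s v & forall j, s j != j -> v i j = 0].
Proof.
move=> sK sk u0 uu hr ik.
(* Conjugation by [1 + e_i w] adds the linear combination [w u] of the lower
   rows to row [i]. *)
pose w (j : 'I_n) := if (j < s j)%N then - u i (s j) else 0.
have wE (j : 'I_n) : (j <= k)%N -> w j = 0 by move=> jk; rewrite /w sk // ltnn.
pose A : 'M[F]_n := \matrix_(a, b) ((a == b)%:R + (a == i)%:R * w b).
have hA : borel_group A.
  apply: borel_intro => [a b ba|a]; rewrite mxE.
    rewrite -val_eqE /= gtn_eqF // add0r; case: eqP => [ai|]; rewrite ?mul0r //.
    by rewrite wE ?mulr0 // -ik -ai ltnW.
  rewrite eqxx; case: (eqVneq a i) => [->|_]; last by rewrite mul0r addr0 oner_eq0.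
  by rewrite wE ?ik // mulr0 addr0 oner_eq0.
have [v e] : exists v, A *m u = v *m A by exists (A *m u *m invmx A); apply/bconjP.
have uv : bconj u v by exists A.
have v0 := bconj_upper uv u0.
(* On these rows the right factor [A] changes nothing, because column [i] of [v] vanishes there. *)
have vE (a b : 'I_n) : (k <= a)%N -> v a b =
  u a b + (a == i)%:R * (if (s b < b)%N then w (s b) else 0).
  move=> ka; have := congr1 (fun x : 'M[F]_n => x a b) e; rewrite !mxE => e'.
  transitivity (\sum_j v a j * A j b).
    rewrite (bigD1 b) //= mxE eqxx; case: (eqVneq b i) => [->|bi].
      rewrite wE ?ik // mulr0 addr0 mulr1 big1 ?addr0 // => j ji.
      by rewrite mxE (negbTE ji) mul0r addr0 mulr0.
    rewrite mul0r addr0 mulr1 big1 ?addr0 // => j jb; rewrite mxE (negbTE jb) add0r.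
    by case: eqP => [->|]; rewrite ?mul0r ?mulr0 // v0 ?ik // mul0r.
  rewrite -e' -sum_N_of // mulr_sumr (bigD1 a) //=.
  under eq_bigr => j ja do rewrite mxE [a == j]eq_sym (negbTE ja) add0r -mulrA.
  rewrite mxE eqxx mulrDl mul1r -addrA; congr (_ + _).
  rewrite [RHS](bigD1 a) //= -mulrA; congr (_ + _).
    case: eqP => [ai|]; rewrite ?mul0r // ?mul1r wE ?ai ?ik //.
    by rewrite !mul0r.
  apply: eq_bigr => j _; congr (_ * _); case: (ltnP k j) => h; first by rewrite (hr j).
  by rewrite wE // !mul0r.
exists v; split=> // [a b ka|j sj].
  rewrite vE ?(ltnW ka) // hr //; case: eqP => [ai|]; rewrite ?mul0r ?addr0 //.
  by move: ka; rewrite ai ik ltnn.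
rewrite vE ?ik // eqxx mul1r; case: (ltnP (s j) j) => h.
  by rewrite /w sK h subrr.
by rewrite addr0; apply: (sq0_row sK u0 uu hr ik); move: sj; rewrite -val_eqE /=; lia.
Qed.

(** Once the row is cleared, it is either zero, and [s] is kept, or its leftmost nonzero entry lies
    in a column [j] fixed by [s], and [(i, j)] becomes a new arc. *)
Lemma normalize_row k s u (i : 'I_n) : involutive s -> (forall a : 'I_n, (a <= k)%N ->
  s a = a) ->
  strictly_upper u -> u *m u = 0 -> normal_rows k.+1 s u -> i = k :> nat ->
  exists (s' : 'S_n) v, [/\ bconj u v, involutive s', forall a : 'I_n, (a < k)%N ->
    s' a = a & normal_rows k s' v].
Proof.
move=> sK sk u0 uu hr ik.
have [v [uv {}hr vi]] := clear_row sK sk u0 uu hr ik.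
have v0 := bconj_upper uv u0; have vv := bconj_sq0 uv uu.
have si : s i = i by rewrite sk // ik.
have [v_i0|] := boolP [forall j, v i j == 0].
  exists s, v; split=> // [a ak|a b]; first by rewrite sk // ltnW.
  rewrite leq_eqVlt => /orP[/eqP ka|/hr //].
  have -> : a = i by apply: ord_inj; rewrite -ka ik.
  by rewrite (eqP (forallP v_i0 b)) mxE si; case: eqP => [->|]; rewrite ?ltnn ?andbF.
case/forallPn => j0 j0P.
case: (arg_minnP (fun j : 'I_n => j : nat) (P := fun j => v i j != 0) j0P) => j vj jmin.
have ij : (i < j)%N by rewrite ltnNge; apply: contra vj => ji; rewrite v0.
have sj : s j = j by apply/eqP; apply: contraNT vj => /vi ->.
have jmin' (b : 'I_n) : (b < j)%N -> v i b = 0.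
  by move=> bj; apply/eqP; apply: contraLR bj => /jmin; rewrite -leqNgt.
have ji : j == i = false by rewrite -val_eqE /= gtn_eqF.
pose t := tperm i j.
have st x : s (t x) = t (s x).
  rewrite /t; case: (tpermP i j x) => [->|->|xi xj].
  - by rewrite sj si tpermL.
  - by rewrite sj si tpermR.
  by rewrite tpermD //; [rewrite -[X in X != _]si|rewrite -[X in X != _]sj];
    rewrite (inj_eq perm_inj) eq_sym; apply/eqP.
pose s' := (s * t)%g.
have s'E x : s' x = t (s x) by rewrite permM.
(* [A] is the identity with row [j] replaced by row [i] of [v], so that
   [e_j A] is that row and [A] commutes with the rows already normalized. *)
pose A : 'M[F]_n := \matrix_(a, b) (if a == j then v i b else (a == b)%:R).
(* Choosing the leftmost nonzero entry as pivot makes [A] upper triangular with nonzero diagonal. *)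
have hA : borel_group A.
  apply: borel_intro => [a b ba|a]; rewrite mxE.
    case: eqP => [aj|_]; first by rewrite jmin' // -aj.
    by rewrite -val_eqE /= gtn_eqF.
  by rewrite eqxx; case: (eqVneq a j) => [->|_] //; exact: oner_neq0.
have [v' e] : exists v', A *m v = v' *m A by exists (A *m v *m invmx A); apply/bconjP.
exists s', v'; split.
- by apply: (bconj_trans uv); exists A.
- by move=> x; rewrite !s'E st sK tpermK.
- move=> a ak; rewrite s'E sk ?(ltnW ak) // tpermD // -val_eqE /= gtn_eqF // ?ik //.
  by rewrite (ltn_trans ak) // -ik.
have rowE (a b : 'I_n) : (k <= a)%N -> (A *m v) a b = (N_of F s' *m A) a b.
  move=> ka; rewrite !mxE; case: (eqVneq a j) => [->|aj].
    (* Row [j] of [A *m v] is row [i] of [v *m v], hence zero, as befits the right end of an arc. *)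
    have := congr1 (fun x : 'M[F]_n => x i b) vv; rewrite !mxE => eb.
    rewrite [RHS]big1 => [|c _]; last first.
      rewrite mxE s'E sj /t tpermR; case: eqP => [<-|]; rewrite ?andbF ?mul0r //.
      by rewrite ltnNge ltnW // mul0r.
    by rewrite -[RHS]eb; apply: eq_bigr => c _; rewrite mxE eqxx.
  rewrite (bigD1 a) //= mxE (negbTE aj) eqxx mul1r big1 ?addr0 => [|c ca]; last first.
    by rewrite mxE (negbTE aj) eq_sym (negbTE ca) mul0r.
  rewrite (bigD1 (s' a)) //= big1 ?addr0 => [|c ca]; last first.
    by rewrite mxE [s' a == c]eq_sym (negbTE ca) andbF mul0r.
  rewrite [N_of _ _ _ _]mxE eqxx andbT mxE s'E.
  case: (eqVneq a i) => [->|ai].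
    by rewrite si /t tpermL eqxx ij mul1r.
  have -> : t (s a) = s a.
    by rewrite /t tpermD //; [rewrite -[X in X != _]si|rewrite -[X in X != _]sj];
      rewrite (inj_eq perm_inj) eq_sym.
  have ka' : (k < a)%N by move: ai; rewrite -val_eqE /=; lia.
  have saj : (s a == j) = false by rewrite -[X in _ == X]sj (inj_eq perm_inj) (negbTE aj).
  rewrite hr // mxE saj.
  case: (eqVneq (s a) b) => [<-|_]; first by rewrite andbT mulr1.
  by rewrite andbF mulr0.
move=> a b ka; have uA : A \in unitmx by case: hA.
have : row a v' = row a (N_of F s').
  apply: (can_inj (mulmxK uA)); rewrite -!row_mul -e.
  by apply/rowP => c; rewrite [LHS]mxE [RHS]mxE rowE.
by move/rowP/(_ b); rewrite !mxE.
Qed.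

(** Elimination runs from the last row upward, starting with the identity permutation; the indices
    not yet treated remain fixed points. *)
Lemma sq0_classification u : strictly_upper u -> u *m u = 0 ->
  exists2 s : 'S_n, involutive s & B_orbit F s u.
Proof.
move=> u0 uu.
suff h k : (k <= n)%N -> exists (s : 'S_n) v, [/\ bconj u v, involutive s,
    forall a : 'I_n, (a < n - k)%N -> s a = a & normal_rows (n - k) s v].
  have [s [v [uv sK _ hr]]] := h n (leqnn n); exists s => //.
  apply/B_orbitE/bconj_sym; suff <- : v = N_of F s by [].
  by apply/matrixP => i j; apply: hr; rewrite subnn.
elim: k => [|k IH] kn.
  exists 1%g, u; split; rewrite ?subn0.
  - exact: bconj_refl.
  - by move=> x; rewrite !perm1.
  - by move=> a _; rewrite perm1.
  by move=> i j; rewrite leqNgt ltn_ord.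
have [s [v [uv sK sk hr]]] := IH (ltnW kn).
have e : (n - k)%N = (n - k.+1).+1 by lia.
have kn' : (n - k.+1 < n)%N by lia.
rewrite e in sk hr.
have [s' [v' [vv' s'K s'k hr']]] :=
  @normalize_row _ s v (Ordinal kn') sK sk (bconj_upper uv u0) (bconj_sq0 uv uu) hr erefl.
by exists s', v'; split=> //; apply: bconj_trans uv vv'.
Qed.
End Classification.

(** * Ranks and minors *)

Section Minors.
Variable F : fieldType.

Lemma row_free_rowsub k r m (A : 'M[F]_(k, m)) (h : 'I_r -> 'I_k) :
  row_free A -> injective h -> row_free (rowsub h A).
Proof.
move=> /row_freeP[B AB] hI; apply/row_freeP; exists (B *m (rowsub h 1%:M)^T).
rewrite mulmxA mul_rowsub_mx AB; apply/matrixP => i j;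
  rewrite !mxE (bigD1 (h i)) //= big1 ?addr0.
  by rewrite !mxE eqxx mul1r (inj_eq hI) eq_sym.
by move=> l li; rewrite !mxE eq_sym (negbTE li) mul0r.
Qed.

(** Minors use increasing indices, whereas the functions selecting independent rows are merely
    injective. *)
Lemma sort_inj k m (f : 'I_k -> 'I_m) : injective f ->
  exists2 h : 'I_k -> 'I_k, injective h & {homo f \o h : a b / (a < b)%N}.
Proof.
move=> fI; pose t := sort (fun x y : 'I_m => x <= y)%N (codom f).
have st : size t = k by rewrite size_sort size_codom card_ord.
have ut : uniq t by rewrite sort_uniq map_inj_uniq // enum_uniq.
have mt x : x \in t = (x \in codom f) by rewrite mem_sort.
have tlt (x0 : 'I_m) a b : (a < b < k)%N -> (nth x0 t a < nth x0 t b)%N.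
  move=> /andP[ab bk].
  have : sorted (fun x y : 'I_m => x <= y)%N t.
    by apply: sort_sorted => x y; exact: leq_total.
  move/(sorted_leq_nth (fun y x z : 'I_m => @leq_trans y x z) (fun x : 'I_m => leqnn x) x0).
  move=> /(_ a b); rewrite !inE st => /(_ (ltn_trans ab bk) bk (ltnW ab)).
  rewrite leq_eqVlt => /orP[/eqP /ord_inj e|//].
  by have := nth_uniq x0 _ _ ut; move=> /(_ a b);
    rewrite st e eqxx => /(_ (ltn_trans ab bk) bk); rewrite (ltn_eqF ab).
have tin (i : 'I_k) : nth (f i) t i \in codom f by rewrite -mt mem_nth // st.
exists (fun i => iinv (tin i)).
  move=> a b /(congr1 f); rewrite !f_iinv (set_nth_default (f b)) ?st // => e.
  by apply/ord_inj/eqP; rewrite -(nth_uniq (f b) _ _ ut) ?st // e.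
move=> a b ab /=; rewrite !f_iinv (set_nth_default (f b)) ?st //; apply: tlt.
by rewrite ab ltn_ord.
Qed.

Lemma rank_le_minors m (M : 'M[F]_m) r :
  (\rank M <= r)%N <-> (forall d, minors r.+1 M d -> d = 0).
Proof.
split=> [rM _ [f [g [_ _ ->]]]|h].
  apply/eqP; apply: contraLR rM; rewrite -unitfE -unitmxE -ltnNge => uM.
  rewrite -(mxrank_unit uM); have -> : mxsub f g M = rowsub f 1%:M *m M *m colsub g 1%:M.
    by rewrite mul_rowsub_mx mul1mx mulmx_colsub mulmx1 -mxsub_comp.
  by apply: leq_trans (mxrankM_maxl _ _) (mxrankM_maxr _ _).
rewrite leqNgt; apply/negP => rM.
(* Conversely, [r.+1] independent rows are kept, then independent columns among them, giving a
   nonzero minor. *)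
have fr : row_free (rowsub (maxrankfun M) M) by exact: maxrowsub_free.
have [h1 h1I h1H] := sort_inj (@maxrankfun_inj _ _ _ M).
pose h2 := h1 \o widen_ord rM.
pose f := maxrankfun M \o h2.
have h2I : injective h2 by move=> a b /h1I /(congr1 val) /= /ord_inj.
have fH : {homo f : a b / (a < b)%N} by move=> a b ab;
  exact: (h1H (widen_ord rM a) (widen_ord rM b)).
have frA : row_free (rowsub f M) by rewrite rowsub_comp row_free_rowsub.
pose A := (rowsub f M)^T.
have fA : row_full A by rewrite /A /row_full mxrank_tr.
have [h3 h3I h3H] := sort_inj (@fullrankfun_inj _ _ _ _ fA).
pose g := fullrankfun fA \o h3.
have : rowsub g A \in unitmx.
  by rewrite -row_free_unit rowsub_comp row_free_rowsub // fullrowsub_free.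
have -> : rowsub g A = (mxsub f g M)^T by apply/matrixP => i j; rewrite !mxE.
by rewrite unitmx_tr unitmxE unitfE => /negP[]; apply/eqP/h; exists f, g.
Qed.

End Minors.

(** * Ranks of windows, as orbit invariants and as arc counts *)

Section Ranks.
Variables (F : fieldType) (n : nat).
Implicit Types (A B : 'M[F]_n) (s u : 'S_n).

Lemma window_inj (i j : 'I_n) : injective (@window n i j).
Proof. by move=> x y /(congr1 val) /= /addnI /ord_inj. Qed.

Lemma window_onto (i j c : 'I_n) : (i <= c <= j)%N -> exists x, @window n i j x = c.
Proof.
move=> h; have lt : (c - i < j.+1 - i)%N by lia.
by exists (Ordinal lt); apply: ord_inj => /=; lia.
Qed.

(** For upper-triangular factors, a summation index outside the window contributes zero. *)
Lemma pi_subM (i j : 'I_n) A B :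
  (forall a b : 'I_n, (b < a)%N -> A a b = 0) -> (forall a b : 'I_n, (b < a)%N ->
    B a b = 0) ->
  pi_sub i j (A *m B) = pi_sub i j A *m pi_sub i j B.
Proof.
move=> A0 B0; apply/matrixP => x y; rewrite !mxE.
under [RHS]eq_bigr => k _ do rewrite !mxE.
rewrite (bigID (mem (codom (@window n i j)))) /= [X in _ + X]big1 ?addr0.
  rewrite -big_uniq /=; last by rewrite map_inj_uniq ?enum_uniq //; exact: window_inj.
  by rewrite /codom big_image.
move=> c; case: (ltnP c (window x)) => h1; first by rewrite A0 ?mul0r.
case: (ltnP (window y) c) => h2; first by rewrite B0 ?mulr0.
move=> /negP[]; have [|z <-] := @window_onto i j c; last exact: codom_f.
move: h1 h2 => /=; have := ltn_ord y; lia.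
Qed.

Lemma bconj_rank (u v : 'M[F]_n) (i j : 'I_n) : strictly_upper u -> bconj u v ->
  \rank (pi_sub i j u) = \rank (pi_sub i j v).
Proof.
move=> u0 uv; have v0 := bconj_upper uv u0; case: uv => A hA e.
have [uA A0] := hA; have [_ B0] := borel_inv hA.
have w (x : 'M[F]_n) : strictly_upper x -> forall a b : 'I_n, (b < a)%N -> x a b = 0.
  by move=> x0 a b ba; apply/x0/ltnW.
have : pi_sub i j A *m pi_sub i j (invmx A) = 1%:M.
  rewrite -pi_subM // mulmxV //; apply/matrixP => x y; rewrite !mxE.
  by rewrite (inj_eq (@window_inj i j)).
case/mulmx1_unit => uP _.
have := congr1 (pi_sub i j) e; rewrite !pi_subM //; [|exact: w|exact: w] => eP.
rewrite -(eqmxMfull (pi_sub i j u) (_ : row_full (pi_sub i j A))) ?row_full_unit //.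
by rewrite eP mxrankMfree // row_free_unit.
Qed.

(** With [S] the left ends of the arcs inside the window, the window factors through dimension
    [#|S|] as [L *m K], where [L] has a left inverse and [K] a right inverse. *)
Lemma rank_N_of s (i j : 'I_n) : involutive s ->
  (\rank (pi_sub i j (N_of F s))).*2 = inner s (itv i j.+1).
Proof.
move=> sK; pose S := [set a : 'I_n | (i <= a)%N && (a < s a <= j)%N]%SET.
have inS a : (a \in S) = (i <= a)%N && (a < s a <= j)%N by rewrite inE.
have -> : inner s (itv i j.+1) = #|S|.*2.
  have e : #|S| = (\sum_a (a \in S))%N.
    by rewrite -sum1_card big_mkcond; apply: eq_bigr => a _; case: ifP.
  rewrite -addnn {2}e (reindex_inj (@perm_inj _ s)) e -big_split /=.
  apply: eq_bigr => a _; rewrite !inS sK /itv -val_eqE /=; lia.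
congr _.*2.
pose L : 'M[F]_(_, #|S|) := \matrix_(x, k) (@window n i j x == enum_val k)%:R.
pose K : 'M[F]_(#|S|, _) := \matrix_(k, y) (s (enum_val k) == @window n i j y)%:R.
have ME : pi_sub i j (N_of F s) = L *m K.
  apply/matrixP => x y; rewrite !mxE.
  case: (boolP (window x \in S)) => xS.
    rewrite (bigD1 (enum_rank_in xS (window x))) //= !mxE enum_rankK_in // eqxx mul1r
      big1 ?addr0.
      by move: xS; rewrite inS => /andP[_ /andP[lt _]]; case: eqP lt => [-> /= ->|];
        rewrite ?andbF.
    move=> k kx; rewrite !mxE; case: eqP => [e|]; last by rewrite mul0r.
    by move/(congr1 (enum_rank_in xS)): e kx; rewrite enum_valK_in => ->; rewrite eqxx.
  rewrite big1 => [|k _]; last first.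
    rewrite !mxE; case: eqP => [e|]; last by rewrite mul0r.
    by case/negP: xS; rewrite e enum_valP.
  case: eqP => [e|]; last by rewrite andbF.
  move: xS; rewrite inS e /= leq_addr andbT /=.
  have -> : (i + y <= j)%N by have := ltn_ord y; lia.
  by rewrite andbT => /negbTE ->.
have SP (k : 'I_#|S|) : (i <= (enum_val k : 'I_n) < s (enum_val k))%N && (s (enum_val k)
  <= j)%N.
  by have := enum_valP k; rewrite inS andbA.
have LL : L^T *m L = 1%:M.
  apply/matrixP => k l; rewrite !mxE.
  have [|x xk] := @window_onto i j (enum_val k); first by have := SP k; lia.
  rewrite (bigD1 x) //= big1 ?addr0 => [|y yx].
    by rewrite !mxE xk eqxx mul1r (inj_eq enum_val_inj).
  by rewrite !mxE -xk (inj_eq (@window_inj i j)) (negbTE yx) mul0r.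
have KK : K *m K^T = 1%:M.
  apply/matrixP => k l; rewrite !mxE.
  have [|x xk] := @window_onto i j (s (enum_val k)); first by have := SP k; lia.
  rewrite (bigD1 x) //= big1 ?addr0 => [|y yx].
    by rewrite !mxE xk eqxx mul1r (inj_eq perm_inj) (inj_eq enum_val_inj) eq_sym.
  by rewrite !mxE -xk (inj_eq (@window_inj i j)) eq_sym (negbTE yx) mul0r.
apply/eqP; rewrite eqn_leq ME; apply/andP; split.
  exact: leq_trans (mxrankM_maxl _ _) (rank_leq_col _).
rewrite -{1}(mxrank1 F #|S|).
have -> : 1%:M = L^T *m (L *m K) *m K^T by rewrite mulmxA LL mul1mx KK.
exact: leq_trans (mxrankM_maxl _ _) (mxrankM_maxr _ _).
Qed.

Lemma inner_itv_small s x y : (y <= x.+1)%N -> inner s (itv x y) = 0%N.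
Proof. by move=> yx; rewrite /inner big1 // => a _; rewrite -val_eqE /itv /=; lia. Qed.

Lemma rank_matrix_inner s (i j : 'I_n) : involutive s ->
  (rank_matrix F s i j).*2 = inner s (itv i j.+1).
Proof.
move=> sK; rewrite mxE; case: ltnP => ij; first exact: rank_N_of.
by rewrite inner_itv_small.
Qed.

Lemma rank_le_inner s u : involutive s -> involutive u ->
  rank_le F u s -> inner_le u s.
Proof.
move=> sK uK us x y.
wlog yn : y / (y <= n)%N.
  move=> hw; case: (leqP y n) => yn; first exact: hw.
  have e : itv x y =1 (itv x n : pred 'I_n) by move=> a; rewrite /itv; have := ltn_ord a;
    lia.
  by rewrite !(eq_inner _ e); apply: hw.
case: (leqP y x.+1) => xy; first by rewrite inner_itv_small.
have xn : (x < n)%N by lia.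
(* Windows include their last index while [itv] excludes its upper bound. *)
have y1n : (y.-1 < n)%N by lia.
have := us (Ordinal xn) (Ordinal y1n).
by rewrite -leq_double !rank_matrix_inner //= prednK //; lia.
Qed.

Lemma rank_le_anti s u : involutive s -> involutive u ->
  rank_le F u s -> rank_le F s u -> s = u.
Proof.
move=> sK uK us su; apply/permP/inner_itv_inj => // x y _.
by apply/eqP; rewrite eqn_leq !rank_le_inner.
Qed.

End Ranks.

(** * The variety *)

Section Variety.
Variables (F : fieldType) (n : nat).
Implicit Types (u : 'M[F]_n) (s : 'S_n).

Lemma ideal_gen0 (T : comPzRingType) (S : set T) : ideal_gen S 0.
Proof. by move=> I [[]]. Qed.

(** The polynomials vanishing at [u] form an ideal. *)
Lemma ideal_gen_vanish u (S : set {mpoly F[nvars n]}) :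
  (forall p, ideal_gen S p -> p.@[coords u] = 0) <-> (forall p, S p -> p.@[coords u] = 0).
Proof.
split=> [h p Sp|h]; first by apply: h; apply: sub_gen_smallest.
apply: (@smallest_sub _ _ _ [set p | p.@[coords u] = 0]) => //.
split=> [|p q /= p0 q0|a p /= p0]; first exact: meval0.
  by rewrite mevalD p0 q0 addr0.
by rewrite mevalM p0 mulr0.
Qed.

Lemma zero_locus_add u (S1 S2 : set {mpoly F[nvars n]}) :
  zero_locus (ideal_add (ideal_gen S1) (ideal_gen S2)) u <->
  [/\ strictly_upper u, forall p, S1 p -> p.@[coords u] = 0 & forall p, S2 p ->
    p.@[coords u] = 0].
Proof.
split=> [[u0 h]|[u0 /ideal_gen_vanish h1 /ideal_gen_vanish h2]].
  split=> //; apply/ideal_gen_vanish => p Sp; apply: h.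
    by exists p => //; exists 0; [exact: ideal_gen0|rewrite addr0].
  by exists 0; [exact: ideal_gen0|exists p => //; rewrite add0r].
split=> // _ [p Sp [q Sq <-]].
by rewrite mevalD h1 // h2 // addr0.
Qed.

Lemma map_generic_mx u : strictly_upper u -> map_mx (meval (coords u)) (generic_mx F n) = u.
Proof.
move=> u0; apply/matrixP => i j; rewrite !mxE; case: ltnP => ij; first exact: meval_x.
by rewrite meval0 u0.
Qed.

(** Evaluation at [u] sends the generic matrix to [u] and commutes with determinants, so the
    generators become the entries of the square and the minors of [u]. *)
Lemma V_P s u : V_ F s u <->
  [/\ strictly_upper u, u *m u = 0 &
      forall i j : 'I_n, (i < j)%N -> (\rank (pi_sub i j u) <= rank_matrix F s i j)%N].
Proof.
apply: (iff_trans (zero_locus_add _ _ _)).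
have sqE (i j : 'I_n) : strictly_upper u ->
    (\sum_(k < n | (j < k < i)%N) x_ F i k * x_ F k j).@[coords u] = (u *m u) j i.
  move=> u0; rewrite mxE raddf_sum /= [RHS](bigID (fun k : 'I_n => (j < k < i)%N)) /=.
  rewrite [X in _ + X]big1 ?addr0 => [|k].
    by apply: eq_bigr => k _; rewrite mevalM !meval_x // mulrC.
  case: (ltnP j k) => jk /=; last by rewrite u0 ?mul0r.
  by rewrite -leqNgt => ik; rewrite (u0 k) ?mulr0.
have minE (i j : 'I_n) r p : strictly_upper u -> minors r (pi_sub i j (generic_mx F n)) p ->
    minors r (pi_sub i j u) p.@[coords u].
  move=> u0 [f [g [fH gH ->]]]; exists f, g; split=> //.
  by rewrite -det_map_mx map_mxsub /pi_sub map_mxsub map_generic_mx.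
have minE' (i j : 'I_n) r d : strictly_upper u -> minors r (pi_sub i j u) d ->
    exists2 p, minors r (pi_sub i j (generic_mx F n)) p & d = p.@[coords u].
  move=> u0 [f [g [fH gH ->]]]; exists (\det (mxsub f g (pi_sub i j (generic_mx F n)))).
    by exists f, g.
  by rewrite -det_map_mx map_mxsub /pi_sub map_mxsub map_generic_mx.
split=> [[u0 h2 h1]|[u0 h2 h1]]; split=> //.
- apply/matrixP => i j; rewrite [RHS]mxE; case: (ltnP i j) => ij.
    by rewrite -sqE //; apply: h2; exists j, i.
  rewrite mxE big1 // => k _; case: (ltnP i k) => ik; last by rewrite u0 ?mul0r.
  by rewrite (u0 k) ?mulr0 // ltnW // (leq_ltn_trans ij).
- move=> i j ij; apply/rank_le_minors => d /(minE' _ _ _ _ u0)[p pP ->].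
  by apply: h1; exists i, j.
- by move=> _ [i [j [ji ->]]]; rewrite sqE // h2 mxE.
move=> p [i [j [ij /(minE _ _ _ _ u0)]]]; apply: (proj1 (rank_le_minors _ _)).
exact: h1.
Qed.

Lemma N_of_sq0 s : involutive s -> N_of F s *m N_of F s = 0.
Proof.
move=> sK; apply/matrixP => i j; rewrite [LHS]mxE [RHS]mxE sum_N_of //.
case: ltnP => // sj; rewrite mxE (inj_eq perm_inj).
by case: eqP => [->|]; rewrite ?andbF // ltnNge ltnW.
Qed.

Lemma B_orbit_V s s' : involutive s' -> rank_le F s' s -> B_orbit F s' `<=` V_ F s.
Proof.
move=> s'K le u us'; have /B_orbitE cu := us'; apply/V_P; split.
- exact: B_orbit_upper us'.
- by apply: bconj_sq0 cu _; apply: N_of_sq0.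
move=> i j ij; rewrite -(bconj_rank _ _ (N_of_upper F s') cu).
by have := le i j; rewrite [rank_matrix _ s' _ _]mxE ij.
Qed.

Lemma B_orbit_rank_le s s' u : B_orbit F s u -> B_orbit F s' u -> rank_le F s s'.
Proof.
move=> /B_orbitE su /B_orbitE s'u i j; rewrite !mxE; case: ifP => // _.
by rewrite (bconj_rank i j (N_of_upper F s) su) (bconj_rank i j (N_of_upper F s') s'u).
Qed.

Lemma V_B_orbit s u : V_ F s u ->
  exists s', [/\ involutive s', rank_le F s' s & B_orbit F s' u].
Proof.
move=> /V_P[u0 uu h]; have [s' s'K us'] := sq0_classification u0 uu; exists s'; split=> //.
move=> i j; rewrite [X in (X <= _)%N]mxE; case: ifP => // ij.
have /B_orbitE cu := us'.
by rewrite (bconj_rank i j (N_of_upper F s') cu) h.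
Qed.

End Variety.

Lemma involutionsP n (s : 'S_n) : involutions s <-> involutive s.
Proof.
rewrite /involutions /= expgS expg1; split=> [h x|h]; first by rewrite -permM h perm1.
by apply/permP => x; rewrite permM h perm1.
Qed.

(** One inclusion holds because the variety is closed and contains the orbit; for the other, each
    point of the variety lies in an orbit below [s], and the degenerations apply. *)
Lemma orbit_closure_variety (F : numFieldType) n (s : 'S_n) : involutive s ->
  zariski_closure (B_orbit F s) = V_ F s.
Proof.
move=> sK; apply/seteqP; split.
  apply: smallest_sub; first by exists (I_ F s).
  by apply: B_orbit_V.
move=> u /V_B_orbit[s' [s'K le us']].
by apply: orbit_closure us'; apply: inner_le_degenerates => //; apply: rank_le_inner le.
Qed.

Theorem theorem3p5 (R : realType) (n : nat) (s : 'S_n) (hs : involutions s) :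
  let below := [set s' | involutions s' /\ rank_le R[i] s' s] in
  [/\ zariski_closure (B_orbit R[i] s) = V_ R[i] s,
      V_ R[i] s = \bigcup_(s' in below) B_orbit R[i] s'
    & trivIset below (fun s' => B_orbit R[i] s')].
Proof.
move=> below; have sK := (involutionsP s).1 hs; split.
- exact: orbit_closure_variety.
- apply/seteqP; split=> [u /V_B_orbit[s' [s'K le us']]|u [s' [hs' le]]].
    by exists s' => //; split=> //; apply/involutionsP.
  by apply: B_orbit_V le _; apply/involutionsP.
(* A common point of two orbits gives both rank inequalities. *)
move=> s1 s2 [/involutionsP s1K _] [/involutionsP s2K _] [u [u1 u2]].
by apply: (rank_le_anti s1K s2K); apply: B_orbit_rank_le; eassumption.
Qed.
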